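(* Let $Q_n = [-1,1]^n \subset \mathbb{R}^n$. The unit vector $\mathbf{a} = (a_1, \ldots, a_n) \in S^{n-1}$ is a critical direction with respect to the central section volume function $\mathrm{Vol}_{n-1}(Q_n \cap \mathbf{a}^\perp)$ if and only if it is parallel to a main diagonal of a 2-dimensional face of $Q_n$, or there exists some $\mu > 0$ for which $$\mathrm{Vol}_{n-1}\big(\mathrm{conv}(\{\mathbf{0}\} \cup (S_k \cap \mathbf{a}^\perp))\big) = \mu\,(1 - a_k^2)$$ holds true for each $k = 1, \ldots, n$, where $S_k = \{\mathbf{x} = (x_1,\ldots,x_n) \in Q_n : x_k = 1\}$.
   Context: $Q_n = [-1,1]^n$ is the standard $n$-dimensional cube, $S^{n-1}$ is the unit sphere of $\mathbb{R}^n$, $\mathbf{0}$ is the origin, $\mathbf{a}^\perp = \{\mathbf{x} \in \mathbb{R}^n : \langle \mathbf{x}, \mathbf{a}\rangle = 0\}$, $\mathrm{conv}$ denotes convex hull, and $\mathrm{Vol}_{n-1}$ denotes $(n-1)$-dimensional volume. $S_k$ is the facet of $Q_n$ on which the $k$th coordinate equals $1$. A critical direction is a unit vector $\mathbf{a}$ that is a critical point on $S^{n-1}$ with respect to the volume of the central section of $Q_n$, that is, of the function $\mathbf{a} \mapsto \mathrm{Vol}_{n-1}(Q_n \cap \mathbf{a}^\perp)$ on $S^{n-1}$. A unit vector is parallel to a main diagonal of a 2-dimensional face of $Q_n$ if, up to permuting the coordinates and changing signs, it equals $(\frac{1}{\sqrt 2}, \frac{1}{\sqrt 2}, 0, \ldots,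 0)$. *)

(* Defs.v *)
From HB Require Import structures.
From mathcomp Require Import all_boot all_order all_algebra all_fingroup.
From mathcomp Require Import all_classical all_reals all_analysis.
Set Implicit Arguments.
Unset Strict Implicit.
Unset Printing Implicit Defensive.
Import Order.TTheory GRing.Theory Num.Theory.
Import numFieldNormedType.Exports.
Local Open Scope classical_set_scope.
Local Open Scope ring_scope.

(** Lebesgue measure on [R^m], carried by [m.-tuple R]: the [m]-fold product of
    [lebesgue_measure], each step being the pushforward of a binary product
    measure along [(x, t) |-> x :: t]. *)

Section lebesgue_cons.
Context (R : realType) (m : nat).
Local Notation T := (measurableTypeR R).
Variable mu : {sigma_finite_measure set (m.-tuple T) -> \bar R}.

Definition cons_pair (p : T * m.-tuple T) : m.+1.-tuple T :=
  [tuple of p.1 :: p.2].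

Definition uncons_pair (t : m.+1.-tuple T) : T * m.-tuple T :=
  (thead t, [tuple of behead t]).

Lemma cons_pairK : cancel cons_pair uncons_pair.
Proof. by move=> [x t]; congr pair; apply: val_inj. Qed.

Lemma measurable_cons_pair : measurable_fun [set: T * m.-tuple T] cons_pair.
Proof. by apply: (@measurable_cons _ _ _ T fst _ snd). Qed.

Lemma measurable_uncons_pair : measurable_fun [set: m.+1.-tuple T] uncons_pair.
Proof.
by apply/measurable_fun_pair; [exact: measurable_tnth|exact: measurable_behead].
Qed.

Definition lebesgue_cons : set (m.+1.-tuple T) -> \bar R :=
  pushforward (@lebesgue_measure R \x mu)%E cons_pair.

Lemma lebesgue_cons0 : lebesgue_cons set0 = 0%E.
Proof. by rewrite /lebesgue_cons /pushforward preimage_set0 measure0. Qed.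

Lemma lebesgue_cons_ge0 A : (0 <= lebesgue_cons A)%E.
Proof. by rewrite /lebesgue_cons /pushforward measure_ge0. Qed.

Lemma lebesgue_cons_sigma_additive : semi_sigma_additive lebesgue_cons.
Proof.
move=> F mF tF mUF; rewrite /lebesgue_cons /pushforward preimage_bigcup.
apply: measure_semi_sigma_additive.
- by move=> i; rewrite -[X in measurable X]setTI; exact: measurable_cons_pair.
- apply/trivIsetP => /= i j _ _ ij; rewrite -preimage_setI.
  by move/trivIsetP : tF => /(_ _ _ _ _ ij) ->//; rewrite preimage_set0.
- rewrite -preimage_bigcup -[X in measurable X]setTI.
  exact: measurable_cons_pair.
Qed.

HB.instance Definition _ := isMeasure.Build _ _ _ lebesgue_cons
  lebesgue_cons0 lebesgue_cons_ge0 lebesgue_cons_sigma_additive.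

Lemma lebesgue_cons_sigma_finite : sigma_finite setT lebesgue_cons.
Proof.
have /sigma_finiteP[F [TF ndF Foo]] := sigma_finiteT (@lebesgue_measure R).
have /sigma_finiteP[G [TG ndG Goo]] := sigma_finiteT mu.
exists (fun i => uncons_pair @^-1` (F i `*` G i)).
  rewrite -preimage_bigcup (_ : \bigcup_i _ = setT) ?preimage_setT//.
  rewrite predeqE => -[x t]; split=> // _.
  have [i _ Fix] : (\bigcup_i F i) x by rewrite -TF.
  have [j _ Gjt] : (\bigcup_j G j) t by rewrite -TG.
  exists (maxn i j) => //; split.
  - by move: x Fix; exact/subsetPset/ndF/leq_maxl.
  - by move: t Gjt; exact/subsetPset/ndG/leq_maxr.
move=> k; have [mF Fk] := Foo k; have [mG Gk] := Goo k; split.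
  rewrite -[X in measurable X]setTI; apply: measurable_uncons_pair => //.
  exact: measurableX.
rewrite /lebesgue_cons /pushforward -comp_preimage.
rewrite (_ : _ \o _ = id) ?preimage_id; last first.
  by apply/funext => p /=; rewrite cons_pairK.
by rewrite product_measure1E// lte_mul_pinfty// ge0_fin_numE.
Qed.

HB.instance Definition _ := Measure_isSigmaFinite.Build _ _ _ lebesgue_cons
  lebesgue_cons_sigma_finite.

End lebesgue_cons.

Fixpoint lebesgueRn (R : realType) (m : nat) :
    {sigma_finite_measure set (m.-tuple (measurableTypeR R)) -> \bar R} :=
  match m with
  | 0 => @dirac _ _ [tuple] R
  | m'.+1 => lebesgue_cons (lebesgueRn R m')
  end.

Section cube.
Context (R : realType) (n : nat).
Implicit Types (a x y g : 'rV[R]_n) (A : set 'rV[R]_n) (f : 'rV[R]_n -> R).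

Definition dotp x y : R := \sum_i x 0 i * y 0 i.

(** The norm of the library on ['rV[R]_n] is the sup norm, so the Euclidean
    unit sphere is defined through [dotp]. *)
Definition usphere : set 'rV[R]_n := [set x | dotp x x = 1].

Definition hyperplane a : set 'rV[R]_n := [set x | dotp x a = 0].

Definition convex_hull A : set 'rV[R]_n :=
  smallest (@convex_set R 'rV[R]_n) A.

(** The rows of [B] form an orthonormal basis of [hyperplane a], i.e.
    [t |-> t *m B] is a linear isometry of [R^(n-1)] onto [hyperplane a]. *)
Definition orthoframe a (B : 'M[R]_(n.-1, n)) : Prop :=
  B *m B^T = 1%:M /\ B *m a^T = 0.

(** The [(n-1)]-dimensional volume of a subset of the hyperplane orthogonal to
    [a <> 0]: the Lebesgue measure on [R^(n-1)] transported by an isometry onto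
    [hyperplane a]. The choice of the isometry is immaterial, the Lebesgue
    measure being invariant under orthogonal transformations. *)
Definition hvol a A : \bar R :=
  lebesgueRn R n.-1
    [set t : (n.-1).-tuple (measurableTypeR R) |
      A ((\row_i tnth t i) *m xget 0 (orthoframe a))].

(** [g] is the (tangential) gradient at [a] of the restriction of [f] to the
    sphere. The little-o does not depend on the norm chosen on ['rV[R]_n]. *)
Definition sphere_gradient f a g : Prop :=
  dotp g a = 0 /\
  (fun x => f x - f a - dotp g (x - a))
    =o_ (within usphere (nbhs a)) (fun x => x - a).

(** As usual for functions that are not everywhere differentiable, the points of
    non-differentiability are critical. The central section function of the cube
    has such points: when [n = 2], it is [x |-> 2 / Num.max `|x 0 0| `|x 0 1|] on
    the unit circle, with corners at the main diagonals. *)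
Definition critical_on_sphere f a : Prop :=
  usphere a /\
  ((~ exists g, sphere_gradient f a g) \/ sphere_gradient f a 0).

Definition cube : set 'rV[R]_n := [set x | forall i, -1 <= x 0 i <= 1].

Definition facet (k : 'I_n) : set 'rV[R]_n := cube `&` [set x | x 0 k = 1].

Definition central_section_volume a : R := fine (hvol a (cube `&` hyperplane a)).

Definition critical_direction a : Prop :=
  critical_on_sphere central_section_volume a.

Definition diagonal_2face a : Prop :=
  exists (s : {perm 'I_n}) (e : 'I_n -> bool), forall i : 'I_n,
    a 0 (s i) = (-1) ^+ e i * (if (i < 2)%N then (Num.sqrt 2)^-1 else 0).

End cube.

(* Main.v *)
(** Up to the factor [1 / |x_j x_k|], the volume of the central section of the
    cube orthogonal to a unit vector [x] is the integral over the remaining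
    coordinates [z] of the trapezoidal density of [x_j U + x_k V], which is a
    combination of four absolute values of affine forms. Hence
    [x_j x_k sigma(x) = Phi(x_j + x_k, x'') - Phi(x_j - x_k, x'')], where
    [Phi(c, v)] is the integral of [|c + <v, z>|] over the cube. [Phi] is
    differentiable away from the origin, and the derivative of [sigma] in the
    [k]-th coordinate is expressed by the integrals of the signs
    [sgn(x_j +- x_k + <x'', z>)], that is by the measure of a slab of the cube,
    which is also, up to scaling, the volume of the cone over the [k]-th facet.
    This gives [a_k t_k = 2 (n - 1) V_k - sigma (1 - a_k^2)] for the tangential
    gradient [t] at [a], and summing over [k] identifies [mu]. The argument of
    [Phi] vanishes only for the diagonals of the 2-faces, where [sigma] has a
    corner along a great circle. *)
Require Import Defs.
From mathcomp Require Import all_boot all_order all_algebra all_fingroup.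
From mathcomp Require Import all_classical all_reals all_analysis.
From mathcomp Require Import measurable_realfun.
From mathcomp Require Import ring lra.
Import Order.TTheory GRing.Theory Num.Theory.
Import numFieldNormedType.Exports.
Set Implicit Arguments.
Unset Strict Implicit.
Unset Printing Implicit Defensive.
Local Open Scope classical_set_scope.
Local Open Scope ring_scope.

(** * Linear changes of variables in R^m *)

(** The formula for [x_j x_k sigma(x)] needs two nonzero coordinates, and it only yields the cone
    over the [k]-th facet for the chosen [k]. So each nonzero [a_k] gets its own pair [(j, k)], and
    uniqueness of tangential gradients shows that all pairs describe one vector. When [a_k = 0], no
    derivative is taken: section and cone are a prism and a pyramid over the same slab. When [a] is
    an axis no pair exists, but near it [sigma(x)] is exactly [2^(n-1) / |x_j|], which is stationary
    there.

    In [sigma (1 - a_k^2)], the [sigma] comes from the quotient rule. The [sigma a_k^2] comes from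
    removing the radial part of the ambient gradient, which is [-sigma] because the quotient is
    homogeneous of degree -1.

    Although the absolute value has a corner, its first-order expansion at [u] is exact for
    increments smaller than [|u|]. The error in [Phi] therefore lives on a thin slab around a null
    hyperplane, and its measure tends to 0 unless the affine form is identically zero. *)

Section measure_scaling.
Local Open Scope ereal_scope.
Context d (X : measurableType d) (R : realType).
Variable mu : {measure set X -> \bar R}.

Lemma ge0_integral_scaled_pushforward (phi : X -> X) (c : {nonneg R})
    (f : X -> \bar R) :
  measurable_fun setT phi ->
  (forall S, measurable S -> mu (phi @^-1` S) = c%:num%:E * mu S) ->
  measurable_fun setT f -> (forall x, 0 <= f x) ->
  \int[mu]_x f (phi x) = c%:num%:E * \int[mu]_x f x.
Proof.
move=> mphi muphi mf f0.
rewrite -ge0_integral_mscale//.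
rewrite -[LHS](ge0_integral_pushforward mphi mu measurableT mf (fun x _ => f0 x)).
by apply: eq_measure_integral => //= A mA _; exact: muphi.
Qed.

End measure_scaling.

Section lebesgue_affine1.
Context (R : realType).
Local Notation T := (measurableTypeR R).
Local Notation leb := (@lebesgue_measure R).

Let measurable_affine1 (d e : R) : measurable_fun [set: T] (fun x : T => x * d + e : T).
Proof. by apply: measurable_funD => //; apply: measurable_funM. Qed.

Lemma lebesgue_measure_affine (d e : R) (S : set T) : d != 0 -> measurable S ->
  leb [set x : T | S (x * d + e)] = (`|d|^-1%:E * leb S)%E.
Proof.
move=> d0 mS.
have nd0 : 0 <= `|d| by [].
suff -> : leb S = (`|d|%:E * leb [set x : T | S (x * d + e)%R])%E.
  by rewrite muleA -EFinM mulVf ?normr_eq0// mul1e.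
(* By uniqueness of Lebesgue measure, it suffices to compare [leb] with [|d|] times this pushforward
   on half-open intervals. A negative [d] turns them into intervals closed on the other side. *)
pose push : {measure set T -> \bar R} :=
  measure_function_pushforward__canonical__measure_function_Measure
    leb (measurable_affine1 d e).
pose mu : {measure set T -> \bar R} := mscale (NngNum nd0) push.
apply: (@lebesgue_measure_unique _ mu) => // _ [[u v] _ <-].
rewrite [RHS](_ : _ = (`|d|%:E *
  leb ((fun x : T => (x * d + e)%R) @^-1` `]u, v]%classic))%E)//.
rewrite lebesgue_measure_itv/= lte_fin.
have [d_gt0|d_lt0|/esym/eqP] := ltgtP 0 d; last by rewrite (negbTE d0).
  have -> : (fun x : T => x * d + e) @^-1` `]u, v]%classic = `](u - e) / d, (v - e) / d]%classic.
    apply/seteqP; split => x /=; rewrite !in_itv/= ltr_pdivrMr// ler_pdivlMr//;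
    by rewrite ltrBlDr lerBrDr.
  rewrite lebesgue_measure_itv/= lte_fin ltr_pM2r ?invr_gt0// ltrD2r.
  case: ifP => _; last by rewrite mule0.
  rewrite -!EFinD -EFinM gtr0_norm//; congr EFin; field; exact: d0.
have -> : (fun x : T => x * d + e) @^-1` `]u, v]%classic = `[(v - e) / d, (u - e) / d[%classic.
  apply/seteqP; split => x /=; rewrite !in_itv/= ltr_ndivlMr// ler_ndivrMr//;
    by rewrite ltrBlDr lerBrDr andbC.
rewrite lebesgue_measure_itv/= lte_fin ltr_nM2r ?invr_lt0// ltrD2r.
case: ifP => _; last by rewrite mule0.
rewrite -!EFinD -EFinM ltr0_norm//; congr EFin; field; exact: d0.
Qed.

Lemma ge0_integral_lebesgue_affine (d e : R) (f : T -> \bar R) : d != 0 ->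
  measurable_fun setT f -> (forall x, 0 <= f x)%E ->
  (\int[leb]_x f (x * d + e)%R = `|d|^-1%:E * \int[leb]_x f x)%E.
Proof.
move=> d0 mf f0; have nd0 : 0 <= `|d|^-1 by rewrite invr_ge0.
rewrite (@ge0_integral_scaled_pushforward _ T _ leb
  (fun x : T => x * d + e : T) (NngNum nd0) f)//.
by move=> S; exact: lebesgue_measure_affine.
Qed.

End lebesgue_affine1.

Section lebesgueRn_fubini.
Context (R : realType).
Local Notation T := (measurableTypeR R).
Local Notation leb := (@lebesgue_measure R).
Local Notation lam := (lebesgueRn R).

Lemma lebesgueRnS m (S : set (m.+1.-tuple T)) : 
  lam m.+1 S = (\int[leb]_x lam m [set t | S (cons_pair (x, t))])%E.
Proof.
rewrite /= /lebesgue_cons /pushforward /product_measure1.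
apply: eq_integral => x _ /=; congr (lam m _).
by apply/seteqP; split => t /=; rewrite /xsection/= inE.
Qed.

Lemma measurable_lebesgueRn_section m (S : set (m.+1.-tuple T)) : measurable S ->
  measurable_fun setT (fun x : T => lam m [set t | S (cons_pair (x, t))]).
Proof.
move=> mS.
have mS' : measurable (@cons_pair R m @^-1` S).
  by rewrite -[X in measurable X]setTI; exact: measurable_cons_pair.
have := measurable_fun_xsection (lam m) mS'.
by apply: eq_measurable_fun => x _ /=; congr (lam m _);
  apply/seteqP; split => t /=; rewrite /xsection/= inE.
Qed.

(** Fubini in the other order, with the head innermost. It serves where the head can be handled
    explicitly for a fixed tail. *)
Lemma lebesgueRnS_swap m (S : set (m.+1.-tuple T)) : measurable S ->
  lam m.+1 S = (\int[lam m]_t leb [set x : T | S (cons_pair (x, t))])%E.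
Proof.
move=> mS.
have mS' : measurable (@cons_pair R m @^-1` S).
  by rewrite -[X in measurable X]setTI; exact: measurable_cons_pair.
rewrite /= /lebesgue_cons /pushforward.
rewrite (@product_measure_unique _ _ _ _ _ _ _ (leb \x^ lam m)%E)//; last first.
  by move=> A B mA mB; rewrite /= product_measure2E.
apply: eq_integral => x _ /=; congr (leb _).
by apply/seteqP; split => t /=; rewrite /ysection/= inE.
Qed.

End lebesgueRn_fubini.

Section affine.
Context (R : realType).
Local Notation T := (measurableTypeR R).
Local Notation leb := (@lebesgue_measure R).
Local Notation lam := (lebesgueRn R).

Definition tv m (t : m.-tuple T) : 'rV[R]_m := \row_i tnth t i.
Definition vt m (v : 'rV[R]_m) : m.-tuple T := [tuple (v 0 i : T) | i < m].
Definition affine m (M : 'M[R]_m) (c : 'rV[R]_m) (t : m.-tuple T) : m.-tuple T :=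
  vt (tv t *m M + c).

Lemma tvK m : cancel (@tv m) (@vt m).
Proof. by move=> t; apply: eq_from_tnth => i; rewrite tnth_mktuple mxE. Qed.

Lemma vtK m : cancel (@vt m) (@tv m).
Proof. by move=> v; apply/rowP => i; rewrite mxE tnth_mktuple. Qed.

Lemma tnth_cons0 m (x : T) (t : m.-tuple T) : tnth (cons_pair (x, t)) 0 = x.
Proof. exact: tnth0. Qed.

Lemma tnth_consS m (x : T) (t : m.-tuple T) i :
  tnth (cons_pair (x, t)) (lift 0 i) = tnth t i.
Proof. by rewrite tnthS; congr (tnth _ _); exact: val_inj. Qed.

Lemma tv_cons m (x : T) (t : m.-tuple T) :
  tv (cons_pair (x, t)) = row_mx (x : R)%:M (tv t) :> 'rV[R]_(1 + m).
Proof.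
apply/rowP => i; rewrite !mxE; case: splitP => j ij.
  have -> : i = 0 by apply/val_inj; rewrite ord1 in ij.
  by rewrite ord1 mxE tnth_cons0.
have -> : i = lift 0 j by exact/val_inj.
by rewrite mxE tnth_consS.
Qed.

Lemma vt_row_mx m (x : R) (v : 'rV[R]_m) :
  vt (row_mx x%:M v : 'rV[R]_m.+1) = cons_pair (x : T, vt v).
Proof. by apply: (can_inj (@tvK _)); rewrite tv_cons !vtK. Qed.

Lemma measurable_sum_coord m (c : 'I_m -> R) :
  measurable_fun setT (fun t : m.-tuple T => \sum_i tnth t i * c i : T).
Proof.
apply: measurable_sum => i; apply: measurable_funM => //.
exact: measurable_tnth.
Qed.

Lemma measurable_affine m (M : 'M[R]_m) c : measurable_fun setT (affine M c).
Proof.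
apply/measurable_fun_tnthP => i.
rewrite (_ : _ \o _ = fun t => (\sum_j tnth t j * M j i) + c 0 i : T).
  apply: measurable_funD => //; exact: measurable_sum_coord.
apply/funext => t /=; rewrite tnth_mktuple !mxE; congr (_ + _).
by apply: eq_bigr => j _; rewrite mxE.
Qed.

Lemma measurable_affine_preimage m (M : 'M[R]_m) c S :
  measurable S -> measurable (affine M c @^-1` S).
Proof. by move=> mS; rewrite -[X in measurable X]setTI; exact: measurable_affine. Qed.

Lemma measurable_cons_section m (x : T) (S : set (m.+1.-tuple T)) :
  measurable S -> measurable [set t | S (cons_pair (x, t))].
Proof.
move=> mS; rewrite -[X in measurable X]setTI.
have : measurable_fun setT (fun t : m.-tuple T => cons_pair (x, t)).
  by apply: (@measurable_cons _ _ _ T (cst x) _ id).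
exact.
Qed.

Lemma measurable_head_section m (t : m.-tuple T) (S : set (m.+1.-tuple T)) :
  measurable S -> measurable [set x : T | S (cons_pair (x, t))].
Proof.
move=> mS; rewrite -[X in measurable X]setTI.
have : measurable_fun setT (fun x : T => cons_pair (x, t)).
  by apply: (@measurable_cons _ _ _ T id _ (cst t)).
exact.
Qed.

(** Quantifying over the translation [c] makes the property usable on the fibres of a
    block-triangular map, where the translation depends on the head coordinate. *)
Definition scales_volume m (M : 'M[R]_m) := forall c S, measurable S ->
  (lam m (affine M c @^-1` S) = `|\det M|^-1%:E * lam m S)%E.

Lemma scales_volume_mul m (M N : 'M[R]_m) :
  scales_volume M -> scales_volume N -> scales_volume (M *m N).
Proof.
move=> sM sN c S mS.
have -> : affine (M *m N) c @^-1` S = affine M 0 @^-1` (affine N c @^-1` S).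
  by apply/seteqP; split => t /=; rewrite /affine vtK addr0 mulmxA.
rewrite sM ?sN//; last exact: measurable_affine_preimage.
by rewrite muleA -EFinM det_mulmx normrM invfM.
Qed.

Lemma affine_ublock m (d : R) (v : 'rV[R]_m) (N : 'M[R]_m) (c : 'rV[R]_(1 + m))
    (x : T) (t : m.-tuple T) :
  affine (block_mx d%:M v 0 N : 'M[R]_(1 + m)) c (cons_pair (x, t)) =
  cons_pair ((x * d + c 0 0 : R) : T, affine N ((x : R) *: v + rsubmx c) t).
Proof.
rewrite /affine tv_cons mul_row_block mulmx0 addr0 -scalar_mxM mul_scalar_mx.
rewrite -{1}(hsubmxK c) add_row_mx -vt_row_mx; congr (vt (row_mx _ _)).
  rewrite raddfD/=; congr (_ + _); apply/rowP => i.
  by rewrite !mxE !ord1/= mulr1n; congr (c _ _); exact/val_inj.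
by rewrite addrAC addrC.
Qed.

Lemma scales_volume_ublock m (d : R) (v : 'rV[R]_m) (N : 'M[R]_m) :
  d != 0 -> scales_volume N ->
  scales_volume (block_mx d%:M v 0 N : 'M[R]_(1 + m)).
Proof.
move=> d0 sN c S mS.
rewrite lebesgueRnS.
under eq_integral => x _.
  rewrite (_ : [set t | _] = affine N ((x : R) *: v + rsubmx c) @^-1`
      [set u | S (cons_pair ((x * d + c 0 0 : R) : T, u))]); last first.
    by apply/seteqP; split => t /=; rewrite affine_ublock.
  rewrite sN; last exact: measurable_cons_section.
  over.
have mf := measurable_lebesgueRn_section mS.
have ? : measurable_fun setT
    (fun x : T => lam m [set u | S (cons_pair ((x * d + c 0 0 : R) : T, u))]).
  apply: (measurableT_comp mf).
  by apply: measurable_funD => //; apply: measurable_funM.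
rewrite ge0_integralZl//=.
rewrite (ge0_integral_lebesgue_affine (c 0 0) d0 mf)// -lebesgueRnS.
by rewrite muleA -EFinM det_ublock det_scalar1 normrM invfM mulrC.
Qed.

Lemma affine_lblock m (w : 'cV[R]_m) (x : T) (t : m.-tuple T) :
  affine (block_mx 1%:M 0 w 1%:M : 'M[R]_(1 + m)) 0 (cons_pair (x, t)) =
  cons_pair ((x * 1 + (tv t *m w) 0 0 : R) : T, t).
Proof.
rewrite /affine tv_cons mul_row_block mulmx0 add0r !mulmx1 addr0 mulr1.
rewrite -[in RHS](tvK t) -vt_row_mx vtK; congr (vt (row_mx _ _)).
by apply/rowP => i; rewrite !mxE ord1 !mulr1n.
Qed.

(** For a fixed tail the head is merely translated, so the head has to be integrated first. The
    translation [c] is split off beforehand and absorbed by the identity matrix. *)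
Lemma scales_volume_lblock m (w : 'cV[R]_m) :
  scales_volume (1%:M : 'M[R]_m) ->
  scales_volume (block_mx 1%:M 0 w 1%:M : 'M[R]_(1 + m)).
Proof.
move=> s1 c S mS.
have -> : affine (block_mx 1%:M 0 w 1%:M : 'M[R]_(1 + m)) c @^-1` S =
    affine (block_mx 1%:M 0 w 1%:M : 'M[R]_(1 + m)) 0 @^-1`
    (affine (1%:M : 'M[R]_(1 + m)) c @^-1` S).
  by apply/seteqP; split => t /=; rewrite /affine vtK addr0 mulmx1.
have mS' := measurable_affine_preimage 1%:M c mS.
rewrite lebesgueRnS_swap; last exact: measurable_affine_preimage.
under eq_integral => t _.
  rewrite (_ : [set x | _] = [set x : T |
      [set y | (affine (1%:M : 'M[R]_(1 + m)) c @^-1` S) (cons_pair (y : T, t))]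
      (x * 1 + (tv t *m w) 0 0)%R]); last first.
    by apply/seteqP; split => x /=; rewrite affine_lblock.
  rewrite lebesgue_measure_affine ?oner_eq0//; last exact: measurable_head_section.
  rewrite normr1 invr1 mul1e.
  over.
rewrite -lebesgueRnS_swap//.
rewrite det_lblock !det1 mulr1 normr1 invr1 mul1e.
rewrite [in LHS]scalar_mx_block scales_volume_ublock ?oner_eq0//.
by rewrite det_ublock !det1 mulr1 normr1 invr1 mul1e.
Qed.

(* A matrix with nonzero corner is a unipotent lower block matrix times an upper
   block matrix (blocks of sizes 1 and [m]), and Fubini handles each factor; a
   transvection makes the corner nonzero. *)
Lemma lebesgueRn_affine m (M : 'M[R]_m) c S : M \in unitmx -> measurable S ->
  (lam m (affine M c @^-1` S) = `|\det M|^-1%:E * lam m S)%E.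
Proof.
move=> uM; move: c S; rewrite -/(scales_volume M).
elim: m M uM => [|m IHm] M uM.
  move=> c S mS; rewrite det_mx00 normr1 invr1 mul1e; congr (lam 0%N _).
  by apply/seteqP; split => t /=; rewrite [affine _ _ _]tuple0 [t]tuple0.
have corner (A : 'M[R]_(1 + m)) : A \in unitmx -> A 0 0 != 0 -> scales_volume A.
  move=> uA d0; set d := A 0 0 in d0.
  pose v := ursubmx A; pose w := dlsubmx A; pose N := drsubmx A.
  have dE : ulsubmx A = d%:M.
    apply/rowP => i; rewrite !mxE !ord1 mulr1n; congr (A _ _); exact: val_inj.
  pose L := block_mx 1%:M 0 (d^-1 *: w) 1%:M : 'M[R]_(1 + m).
  pose U := block_mx d%:M v 0 (N - d^-1 *: (w *m v)) : 'M[R]_(1 + m).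
  have AE : A = L *m U.
    rewrite mulmx_block !mul1mx !mul0mx !addr0 -[LHS]submxK dE.
    by rewrite -!scalemxAl [X in _ = block_mx _ _ _ X]addrC subrK mul_mx_scalar scalerA mulVf ?scale1r.
  have uN : N - d^-1 *: (w *m v) \in unitmx.
    move: uA; rewrite AE !unitmxE det_mulmx unitrM => /andP[_].
    by rewrite det_ublock unitrM => /andP[].
  rewrite AE; apply: scales_volume_mul.
    by apply: scales_volume_lblock => //; exact/IHm/unitmx1.
  by apply: scales_volume_ublock => //; exact: IHm.
have [M00|] := eqVneq (M 0 0) 0; last exact: corner.
have [i Mi] : exists i : 'I_m, M (lift 0 i) 0 != 0.
  apply/existsP; apply: contraLR uM => /existsPn Mi0.
  rewrite unitmxE (expand_det_col _ 0) big1 ?unitr0// => i _.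
  case: (unliftP 0 i) => [j ->|->]; last by rewrite M00 mul0r.
  by move: (Mi0 j) => /negPn/eqP ->; rewrite mul0r.
pose E u := block_mx 1%:M u 0 1%:M : 'M[R]_(1 + m).
have uE u : E u \in unitmx.
  by rewrite unitmxE det_ublock !det1 mulr1 unitr1.
have -> : M = E (- delta_mx 0 i) *m (E (delta_mx 0 i) *m M).
  rewrite mulmxA mulmx_block !mul1mx !mul0mx !mulmx1 !mulmx0 !addr0 add0r subrr.
  by rewrite -scalar_mx_block mul1mx.
apply: scales_volume_mul.
  by apply: scales_volume_ublock; [exact: oner_neq0|exact/IHm/unitmx1].
apply: corner; first by rewrite unitmx_mul uE.
have EE (u : 'rV[R]_m) j : E u 0 (lift 0 j) = u 0 j.
  have -> : lift 0 j = rshift 1 j by exact: val_inj.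
  have -> : 0 = lshift m (0 : 'I_1) by exact: val_inj.
  by rewrite /E block_mxEur.
rewrite mxE big_ord_recl M00 mulr0 add0r (bigD1 i)//= big1 => [|j ji].
  by rewrite EE mxE !eqxx mul1r addr0.
by rewrite EE mxE (negbTE ji) andbF mul0r.
Qed.

End affine.

(** * Slabs of the cube *)

Section cube_tuples.
Context (R : realType).
Local Notation T := (measurableTypeR R).
Local Notation leb := (@lebesgue_measure R).
Local Notation lam := (lebesgueRn R).

Definition affine_form m (c : R) (v : 'rV[R]_m) (t : m.-tuple T) : T :=
  c + \sum_i tnth t i * v 0 i.

Lemma measurable_affine_form m (c : R) (v : 'rV[R]_m) :
  measurable_fun setT (affine_form c v).
Proof. by apply: measurable_funD => //; exact: measurable_sum_coord. Qed.

Lemma affine_form_cons m c (v : 'rV[R]_m.+1) (x : T) (t : m.-tuple T) :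
  affine_form c v (cons_pair (x, t)) =
  affine_form (c + x * v 0 0) (\row_i v 0 (lift 0 i)) t.
Proof.
rewrite /affine_form big_ord_recl addrA tnth_cons0; congr (_ + _).
by apply: eq_bigr => i _; rewrite tnth_consS !mxE.
Qed.

Lemma lebesgueRn_setX m (A : set T) (B : set (m.-tuple T))
    (S : set (m.+1.-tuple T)) : measurable A -> measurable B ->
  (forall x t, S (cons_pair (x, t)) <-> A x /\ B t) ->
  (lam m.+1 S = leb A * lam m B)%E.
Proof.
move=> mA mB SAB; rewrite /= /lebesgue_cons /pushforward -product_measure1E//.
congr (_ _); apply/seteqP; split=> -[x t] /=; first by move/SAB.
by move=> ?; apply/SAB.
Qed.

(** By Fubini: if the tail of [v] is nonzero, every section is null by induction. Otherwise the form
    depends on the head alone and vanishes for at most one value of it. *)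
Lemma lebesgueRn_affine_form_eq0 m (c : R) (v : 'rV[R]_m) : (c != 0) || (v != 0) ->
  lam m [set t | affine_form c v t = 0] = 0%E.
Proof.
have mz (u : T) : measurable [set u] by exact: measurable_set1.
elim: m c v => [|m IHm] c v cv.
  have v0 : v = 0 by apply/rowP => -[].
  rewrite v0 eqxx orbF in cv; rewrite (_ : [set _ | _] = set0) ?measure0//.
  by rewrite -subset0 => t /=; rewrite /affine_form big_ord0 addr0; exact/eqP.
pose v' := \row_i v 0 (lift 0 i).
have [v'0|v'0] := eqVneq v' 0; last first.
  rewrite lebesgueRnS integral0_eq// => x _.
  rewrite (_ : [set _ | _] = [set t | affine_form (c + x * v 0 0) v' t = 0]).
    by rewrite IHm// v'0 orbT.
  by apply/seteqP; split => t /=; rewrite affine_form_cons.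
have formE x t : affine_form c v (cons_pair (x, t)) = c + x * v 0 0.
  by rewrite affine_form_cons -/v' v'0 /affine_form big1 ?addr0// => i _;
    rewrite mxE mulr0.
have [v00|v00] := eqVneq (v 0 0) 0.
  have c0 : c != 0.
    case/orP: cv => //; apply: contraNneq => _; apply/eqP/rowP => i; rewrite mxE.
    case: (unliftP 0 i) => [j ->|->//].
    by move/rowP : v'0 => /(_ j); rewrite !mxE.
  rewrite (@lebesgueRn_setX _ set0 setT)//; first by rewrite measure0 mul0e.
  move=> x t /=; rewrite formE v00 mulr0 addr0; split; last by case.
  by move/eqP; rewrite (negbTE c0).
rewrite (@lebesgueRn_setX _ [set (- c / v 0 0 : T)] setT)//.
  by rewrite lebesgue_measure_set1 mul0e.
move=> x t /=; rewrite formE; split => [xE|[-> _]].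
  by split => //; apply: (mulIf v00); rewrite divfK//; apply/eqP; rewrite -addr_eq0 addrC xE.
by rewrite divfK// subrr.
Qed.

Definition qcube m : set (m.-tuple T) := [set t | forall i, -1 <= tnth t i <= 1].

Lemma measurable_itv_preimage m (f : m.-tuple T -> T) (a b : R) :
  measurable_fun setT f -> measurable [set t | a <= f t <= b].
Proof.
move=> mf; rewrite (_ : [set _ | _] = setT `&` f @^-1` `[a, b]%classic).
  exact: mf.
by rewrite setTI; apply/seteqP; split => t /=; rewrite in_itv.
Qed.

Lemma measurable_bigcap_ord k m (F : 'I_k -> set (m.-tuple T)) :
  (forall i, measurable (F i)) -> measurable [set t | forall i, F i t].
Proof.
move=> mF; rewrite (_ : [set t | _] = \bigcap_(i in setT) F i).
  by apply: fin_bigcap_measurable => [//|i _]; exact: mF.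
by apply/seteqP; split => t /= Ft i; [move=> _|]; exact: Ft.
Qed.

Lemma measurable_qcube m : measurable (@qcube m).
Proof.
apply: measurable_bigcap_ord => i; apply: measurable_itv_preimage.
exact: measurable_tnth.
Qed.

Lemma qcube_cons m (x : T) (t : m.-tuple T) :
  qcube (cons_pair (x, t)) <-> (-1 <= x <= 1) /\ qcube t.
Proof.
split=> [Q|[x1 Q] i].
  split; first by have := Q 0; rewrite tnth_cons0.
  by move=> i; have := Q (lift 0 i); rewrite tnth_consS.
case: (unliftP 0 i) => [j ->|->]; last by rewrite tnth_cons0.
by rewrite tnth_consS.
Qed.

Lemma lebesgueRn_qcube m : lam m (@qcube m) = (2 ^+ m)%:E.
Proof.
elim: m => [|m IHm].
  by rewrite expr0 /= diracE mem_set// => -[].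
have mQ := @measurable_qcube m.
rewrite (@lebesgueRn_setX _ `[-1, 1]%classic (@qcube m))//; last first.
  by move=> x t; rewrite qcube_cons/= in_itv.
rewrite IHm lebesgue_measure_itv/= lte_fin gtrN// ?ltr01//.
by rewrite -EFinD -EFinM opprK exprS.
Qed.

Lemma lebesgueRn_qcubeI_lty m (A : set (m.-tuple T)) : measurable A ->
  (lam m (@qcube m `&` A) < +oo)%E.
Proof.
move=> mA; rewrite (le_lt_trans _ (ltry (2 ^+ m)))// -lebesgueRn_qcube.
have mQ := @measurable_qcube m.
by rewrite le_measure ?inE//; apply: measurableI.
Qed.

Lemma measurable_affine_form_itv m (c : R) (v : 'rV[R]_m) (a b : R) :
  measurable [set t | a <= affine_form c v t <= b].
Proof. by apply: measurable_itv_preimage; exact: measurable_affine_form. Qed.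

(** Continuity from above: the slabs of half-width [1 / (n + 1)] decrease to a subset of the null
    zero set of the form. This is what makes [Phi] differentiable. *)
Lemma qcube_slab_small m (c : R) (v : 'rV[R]_m) (e : R) :
  (c != 0) || (v != 0) -> 0 < e ->
  exists2 d, 0 < d &
    (lam m (@qcube m `&` [set t | (- d <= affine_form c v t <= d)%R]) < e%:E)%E.
Proof.
move=> cv e0.
have mQ := @measurable_qcube m.
pose F n := @qcube m `&` [set t | - n.+1%:R^-1 <= affine_form c v t <= n.+1%:R^-1].
have mF n : measurable (F n).
  by apply: measurableI => //; exact: measurable_affine_form_itv.
have capF : lam m (\bigcap_n F n) = 0%E.
  apply: (@subset_measure0 _ _ _ _ _ [set t | affine_form c v t = 0]) => //.
  - exact: bigcap_measurable.
  - rewrite (_ : [set _ | _] = [set t | 0 <= affine_form c v t <= 0]).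
      exact: measurable_affine_form_itv.
    by apply/seteqP; split => t /=; rewrite -eq_le eq_sym => /eqP.
  - move=> t Ft /=; apply/eqP; rewrite -normr_le0; apply/ler_addgt0Pl => d d0.
    rewrite addr0; near \oo => n.
    have [_ /=] := Ft n Logic.I; rewrite -ler_norml => /le_trans; apply.
    apply: ltW; near: n; exact: (near_infty_natSinv_lt (PosNum d0)).
  - exact: lebesgueRn_affine_form_eq0.
have cvgF : lam m \o F @ \oo --> 0%E.
  rewrite -capF; apply: nonincreasing_cvg_mu => //.
  - by apply: lebesgueRn_qcubeI_lty; exact: measurable_affine_form_itv.
  - exact: bigcap_measurable.
  - move=> n k nk; apply/subsetPset => t [Qt /= /andP[ut tu]]; split => //=.
    have le_inv : k.+1%:R^-1 <= n.+1%:R^-1 :> R by rewrite lef_pV2 ?posrE// ler_nat.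
    by rewrite (le_trans _ ut) ?lerN2// (le_trans tu).
have [] : \forall n \near \oo, (lam m (F n) < e%:E)%E.
  have e0' : (0 < e%:E)%E by rewrite lte_fin.
  exact: (cvgF _ (open_ereal_lt' e0')).
by move=> n _ /(_ n (leqnn n)) ?; exists n.+1%:R^-1; rewrite ?invr_gt0.
Unshelve. all: by end_near.
Qed.

End cube_tuples.

(** * Volumes in a hyperplane by projection along a coordinate *)

Section section_volume.
Context (R : realType).
Local Notation T := (measurableTypeR R).
Local Notation lam := (lebesgueRn R).

Lemma dotpC n (x y : 'rV[R]_n) : dotp x y = dotp y x.
Proof. by apply: eq_bigr => i _; rewrite mulrC. Qed.

Lemma dotpE n (x y : 'rV[R]_n) : dotp x y = (x *m y^T) 0 0.
Proof. by rewrite mxE; apply: eq_bigr => i _; rewrite mxE. Qed.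

Lemma mulmx_trE n (x y : 'rV[R]_n) : x *m y^T = (dotp x y)%:M.
Proof. by rewrite [LHS]mx11_scalar dotpE. Qed.

Lemma dotp_eq0 n (x : 'rV[R]_n) : (dotp x x == 0) = (x == 0).
Proof.
rewrite psumr_eq0 => [|i _]; last by rewrite -expr2 sqr_ge0.
apply/allP/eqP => [x0|-> i _]; last by rewrite !mxE mulr0 eqxx.
apply/rowP => i; rewrite mxE; apply/eqP.
by have := x0 i (mem_index_enum _); rewrite mulf_eq0 orbb.
Qed.

(* Householder: the reflection exchanging [a] and the first basis vector. *)
Lemma orthogonal_completion N (a : 'rV[R]_N.+1) : usphere a ->
  exists2 H : 'M[R]_N.+1, H *m H^T = 1%:M & row 0 H = a.
Proof.
move=> a1; pose e : 'rV[R]_N.+1 := delta_mx 0 0.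
have ee : dotp e e = 1.
  rewrite /dotp (bigD1 0)//= big1 => [|i i0]; rewrite !mxE ?eqxx ?mulr1 ?addr0//.
  by rewrite (negbTE i0) mulr0.
have ea : dotp e a = a 0 0.
  rewrite /dotp (bigD1 0)//= big1 => [|i i0]; rewrite !mxE ?eqxx ?mul1r ?addr0//.
  by rewrite (negbTE i0) mul0r.
have rowe (M : 'M[R]_N.+1) : row 0 M = e *m M by rewrite rowE.
have [ae|ae] := eqVneq a e.
  by exists 1%:M; rewrite ?trmx1 ?mulmx1// rowe mulmx1.
pose v := e - a; pose q := dotp v v.
have q0 : q != 0 by rewrite dotp_eq0 subr_eq0 eq_sym.
have qE : q = 2 * (1 - a 0 0).
  rewrite /q /v !dotpE linearB/= mulmxBl !mulmxBr !mulmx_trE !mxE/= !mulr1n.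
  by rewrite ee (dotpC a) ea a1; ring.
pose H := 1%:M - (2 / q) *: (v^T *m v).
have HT : H^T = H by rewrite linearB/= trmx1 linearZ/= trmx_mul trmxK.
exists H.
  rewrite HT mulmxBl mul1mx mulmxBr mulmx1 -scalemxAl -scalemxAr scalerA.
  rewrite mulmxA -(mulmxA v^T) mulmx_trE -/q mul_mx_scalar -scalemxAl scalerA.
  rewrite /H -scalerBl -addrA -opprD -scalerDl (_ : 2 / q + _ = 0).
    by rewrite scale0r subr0.
  by field.
rewrite rowe mulmxBr mulmx1 -scalemxAr mulmxA mulmx_trE mul_scalar_mx scalerA.
have -> : dotp e v = q / 2.
  rewrite /v dotpE linearB/= mulmxBr !mulmx_trE !mxE/= !mulr1n ee ea qE.
  by field.
by rewrite (_ : _ * _ = 1) ?scale1r ?subKr//; field.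
Qed.

Lemma orthoframe_exists N (a : 'rV[R]_N.+1) : usphere a ->
  orthoframe a (xget 0 (orthoframe a)).
Proof.
move=> /orthogonal_completion[H HH Ha]; apply: xgetPex.
exists (row' 0 H : 'M[R]_(N.+1.-1, N.+1)).
have Hij i j : (row i H *m (row j H)^T) 0 0 = (i == j)%:R.
  have /matrixP/(_ i j) := HH; rewrite !mxE => <-.
  by apply: eq_bigr => k _; rewrite !mxE.
split; apply/matrixP => i j; rewrite !mxE.
  rewrite -(inj_eq (@lift_inj _ 0)) -Hij !mxE.
  by apply: eq_bigr => k _; rewrite !mxE.
transitivity ((lift 0 i == 0)%:R : R) => //; rewrite -Hij Ha mxE ord1.
by apply: eq_bigr => k _; rewrite !mxE.
Qed.

(** Since the inverse of [O] is its transpose, the adjugate is [\det O] times the transpose.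
    Comparing corner entries gives the claim, as the determinant has modulus 1. *)
Lemma det_minor_orthogonal N (O : 'M[R]_N.+1) : O *m O^T = 1%:M ->
  `|\det (row' 0 (col' 0 O))| = `|O 0 0|.
Proof.
move=> OO; have /(congr1 (mulmx O^T)) := mul_mx_adj O.
rewrite mulmxA (mulmx1C OO) mul1mx mul_mx_scalar => /matrixP/(_ 0 0).
rewrite !mxE /cofactor addn0 expr0 mul1r => ->; rewrite normrM.
have /(congr1 (fun M => `|\det M|)) := OO.
rewrite det_mulmx det_tr det1 normr1 normrM -expr2 => /eqP.
by rewrite sqrp_eq1// => /eqP ->; rewrite mul1r.
Qed.

(* Parametrizes [hyperplane a] by all the coordinates but the [s 0]-th one. *)
Definition hyperplane_point N (a : 'rV[R]_N.+1) (s : {perm 'I_N.+1})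
    (t : N.-tuple T) : 'rV[R]_N.+1 :=
  \row_i if unlift 0 ((s^-1)%g i) is Some j then tnth t j
         else - (\sum_j tnth t j * a 0 (s (lift 0 j))) / a 0 (s 0).

Lemma hyperplane_point_head N (a : 'rV[R]_N.+1) (s : {perm 'I_N.+1}) (t : N.-tuple T) :
  hyperplane_point a s t 0 (s 0) =
  - (\sum_j tnth t j * a 0 (s (lift 0 j))) / a 0 (s 0).
Proof. by rewrite mxE permK unlift_none. Qed.

Lemma hyperplane_point_tail N (a : 'rV[R]_N.+1) (s : {perm 'I_N.+1})
    (t : N.-tuple T) j :
  hyperplane_point a s t 0 (s (lift 0 j)) = tnth t j.
Proof. by rewrite mxE permK liftK. Qed.

Lemma dotp_perm N (x y : 'rV[R]_N.+1) (s : {perm 'I_N.+1}) : dotp x y =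
  x 0 (s 0) * y 0 (s 0) + \sum_j x 0 (s (lift 0 j)) * y 0 (s (lift 0 j)).
Proof. by rewrite /dotp (reindex_perm s) big_ord_recl. Qed.

Lemma forall_perm N (s : {perm 'I_N.+1}) (P : 'I_N.+1 -> Prop) :
  (forall i, P i) <-> P (s 0) /\ forall j, P (s (lift 0 j)).
Proof.
split=> [Pi|[P0 PS] i]; first by split.
by rewrite -(permKV s i); case: (unliftP 0 ((s^-1)%g i)) => [j|] ->.
Qed.

Lemma dotp_hyperplane_point N (a : 'rV[R]_N.+1) (s : {perm 'I_N.+1}) (t : N.-tuple T) : a 0 (s 0) != 0 ->
  dotp (hyperplane_point a s t) a = 0.
Proof.
move=> as0; rewrite (dotp_perm _ _ s) hyperplane_point_head divfK//.
by under [X in _ + X]eq_bigr do rewrite hyperplane_point_tail; rewrite addNr.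
Qed.

(** Projecting [hyperplane a] along coordinate [s 0] shrinks volume by the cosine [|a 0 (s 0)|]. The
    result does not depend on the frame picked by [xget]. *)
Lemma hvolE N (a : 'rV[R]_N.+1) (s : {perm 'I_N.+1}) (A : set 'rV[R]_N.+1) :
  usphere a -> a 0 (s 0) != 0 ->
  measurable [set t | A (hyperplane_point a s t)] ->
  (hvol a A = `|a 0 (s 0)|^-1%:E * lam N [set t | A (hyperplane_point a s t)])%E.
Proof.
move=> a1 as0 mA; rewrite /hvol.
have [/= BB Ba] := orthoframe_exists a1.
set B := xget _ _ in BB Ba *.
(* [M] is the frame followed by the projection. It is also a minor of the orthogonal matrix with
   rows [a] and [B], complementary to the entry [a 0 (s 0)]. *)
pose M := row' 0 (col' 0 (col_perm s (col_mx a B : 'M[R]_(1 + N)))) : 'M[R]_N.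
have detM : `|\det M| = `|a 0 (s 0)|.
  rewrite /M det_minor_orthogonal.
    by rewrite mxE (_ : 0 = lshift N (0 : 'I_1)) ?col_mxEu//; exact: val_inj.
  have OO : (col_mx a B : 'M[R]_(1 + N)) *m (col_mx a B : 'M[R]_(1 + N))^T = 1%:M.
    have aB : a *m B^T = 0 by rewrite -[LHS]trmxK trmx_mul trmxK Ba trmx0.
    have aa : dotp a a = 1 := a1.
    by rewrite tr_col_mx mul_col_row mulmx_trE aa Ba aB BB -scalar_mx_block.
  rewrite -[RHS]OO; apply/matrixP => i j; rewrite !mxE [RHS](reindex_perm s)/=.
  by apply: eq_bigr => k _; rewrite !mxE.
rewrite -detM -(@lebesgueRn_affine _ _ M 0)//; last first.
  by rewrite unitmxE unitfE -normr_eq0 detM normr_eq0.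
congr (lam N _).
suff E t : hyperplane_point a s (affine M 0 t) = (\row_i tnth t i) *m B.
  by apply/seteqP; split => t /=; rewrite E.
set x := RHS.
have xa : dotp x a = 0 by rewrite dotpE -mulmxA Ba mulmx0 mxE.
have xM j : tnth (affine M 0 t) j = x 0 (s (lift 0 j)).
  rewrite tnth_mktuple addr0 !mxE; apply: eq_bigr => k _; congr (_ * _).
  have kE : lift 0 k = rshift 1 k by exact: val_inj.
  by rewrite -[RHS](@col_mxEd _ 1 N N.+1 a B) -kE; do 3 rewrite mxE.
apply/rowP; apply/(forall_perm s); split => [|j]; last first.
  by rewrite hyperplane_point_tail.
rewrite hyperplane_point_head; apply: (mulIf as0); rewrite divfK//.
apply/eqP; rewrite eqr_oppLR; apply/eqP.
move: xa; rewrite (dotp_perm _ _ s) => /eqP.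
rewrite addr_eq0 => /eqP ->; rewrite opprK.
by apply: eq_bigr => j _; rewrite xM.
Qed.

End section_volume.

(** * Cones over the facets *)

Section cones.
Context (R : realType).
Local Notation T := (measurableTypeR R).
Local Notation leb := (@lebesgue_measure R).
Local Notation lam := (lebesgueRn R).

(** A point with [x 0 k > 0] on the right is the combination of [0] and [x / x_k], which lies in the
    facet, with weight [x_k]. If the facet misses the hyperplane, both sides reduce to the
    origin. *)
Lemma convex_hull_facet n (a : 'rV[R]_n) k :
  convex_hull ([set 0] `|` (facet k `&` hyperplane a)) =
  [set x | hyperplane a x /\ (x 0 k <= 1 /\ forall i, `|x 0 i| <= x 0 k)].
Proof.
apply/seteqP; split=> [x|x [xa [xk1 xik]]].
  apply; split=> [y z p|y [->|[[yQ yk] ya]]].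
  - rewrite !inE => -[ya [yk1 yik]] [za [zk1 zik]].
    have p0 : 0 <= p%:num by [].
    have q0 : 0 <= 1 - p%:num by rewrite subr_ge0.
    have E i : (conv p y z : 'rV[R]_n) 0 i = p%:num * y 0 i + (1 - p%:num) * z 0 i.
      by rewrite !mxE.
    split; [|split=> [|i]].
    + move: ya za; rewrite /hyperplane/= !dotpE mulmxDl -!scalemxAl !mxE.
      by move=> -> ->; rewrite !mulr0 addr0.
    + rewrite E; nra.
    + rewrite !E (le_trans (ler_normD _ _))// !normrM (ger0_norm p0) (ger0_norm q0).
      by rewrite lerD// ler_wpM2l.
  - split; last by split=> [|i]; rewrite !mxE ?normr0.
    by rewrite /hyperplane/= /dotp big1// => i _; rewrite mxE mul0r.
  - by split=> //; rewrite yk; split=> // i; rewrite ler_norml; exact: yQ.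
move=> A [cA sA].
have [xk0|xk0] := eqVneq (x 0 k) 0.
  apply: sA; left; apply/rowP => i; apply/eqP.
  by rewrite mxE -normr_le0 -xk0; exact: xik.
have xk_gt0 : 0 < x 0 k by rewrite lt_def xk0 (le_trans _ (xik k)).
pose y := (x 0 k)^-1 *: x.
have Ay : A y.
  apply: sA; right; split; [split=> [i|]|].
  - rewrite -ler_norml mxE normrM normfV (gtr0_norm xk_gt0) mulrC.
    by rewrite ler_pdivrMr// mul1r.
  - by rewrite /= mxE mulVf.
  - rewrite /hyperplane/= dotpE -scalemxAl mxE -dotpE.
    by move: xa; rewrite /hyperplane/= => ->; rewrite mulr0.
have A0 : A 0 by apply: sA; left.
have := cA y 0 (Itv01 (ltW xk_gt0) xk1).
rewrite !inE => /(_ Ay A0); congr (A _).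
by rewrite /conv/= scaler0 addr0 scalerA divff// scale1r.
Qed.

Definition slab m (c : R) (v : 'rV[R]_m) (h : R) : set (m.-tuple T) :=
  @qcube R m `&` [set z | - h <= affine_form c v z <= h].

Lemma measurable_slab m c (v : 'rV[R]_m) h : measurable (slab c v h).
Proof.
by apply: measurableI; [exact: measurable_qcube|exact: measurable_affine_form_itv].
Qed.

Lemma slab_lty m c (v : 'rV[R]_m) h : (lam m (slab c v h) < +oo)%E.
Proof. by apply: lebesgueRn_qcubeI_lty; exact: measurable_affine_form_itv. Qed.

Lemma slab_fin_num m c (v : 'rV[R]_m) h : (lam m (slab c v h) \is a fin_num)%E.
Proof. by rewrite ge0_fin_numE ?slab_lty. Qed.

Definition row_tail m (b : 'rV[R]_m.+1) : 'rV[R]_m := \row_i b 0 (lift 0 i).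

(** The cone over the [k]-th facet after projecting out coordinate [j]. The head is the height
    [x_k], and with [h = |a_j|] the last inequality is [|x_j| <= x_k] multiplied by [|a_j|]. *)
Definition slab_cone m (b : 'rV[R]_m.+1) (h : R) : set (m.+1.-tuple T) :=
  [set t | [/\ tnth t 0 <= 1, forall i, `|tnth t i| <= tnth t 0 &
    `|affine_form 0 b t| <= h * tnth t 0]].

Lemma measurable_le_set d (X : measurableType d) (f g : X -> T) :
  measurable_fun setT f -> measurable_fun setT g ->
  measurable [set x | f x <= g x].
Proof.
move=> mf mg; rewrite (_ : [set _ | _] = setT `&` (g \- f) @^-1` `[0, +oo[%classic).
  exact: measurable_funB.
by rewrite setTI; apply/seteqP; split=> x /=; rewrite in_itv/= andbT subr_ge0.
Qed.

Lemma measurable_norm_comp d (X : measurableType d) (f : X -> T) :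
  measurable_fun setT f -> measurable_fun setT (fun x => `|f x| : T).
Proof. by move=> mf; apply: (measurableT_comp _ mf); exact: normr_measurable. Qed.

Lemma measurable_slab_cone m (b : 'rV[R]_m.+1) h : measurable (slab_cone b h).
Proof.
have mt i := @measurable_tnth _ T m.+1 i.
rewrite (_ : slab_cone b h = [set t | tnth t 0 <= 1] `&`
    [set t | forall i, `|tnth t i| <= tnth t 0] `&`
    [set t | `|affine_form 0 b t| <= h * tnth t 0]); last first.
  by apply/seteqP; split => t [] => [? ? ?|[? ?] ?]; split.
apply: measurableI; first apply: measurableI.
- exact: (@measurable_le_set _ _ (fun t => tnth t 0) (cst 1)).
- apply: measurable_bigcap_ord => i; apply: measurable_le_set => //.
  exact: measurable_norm_comp.
- have mg : measurable_fun setT (fun t : m.+1.-tuple T => h * tnth t 0 : T).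
    by apply: measurable_funM => //; exact: mt.
  apply: measurable_le_set mg; apply: measurable_norm_comp.
  exact: measurable_affine_form.
Qed.

(** At height [x] the section is the slab dilated by [x]. Height [0], where one cannot rescale, is
    discarded as a null set in [lebesgueRn_slab_cone]. *)
Lemma slab_cone_section m (b : 'rV[R]_m.+1) (h : R) (x : T) : x != 0 ->
  (lam m [set z | slab_cone b h (cons_pair (x, z))] =
   (x ^+ m)%:E * (\1_`[0%R, 1%R] x)%:E *
     lam m (slab (b 0 0)%R (row_tail b) h))%E.
Proof.
move=> x0; rewrite indicE mem_setE/= in_itv/=.
have [/andP[x_ge0 x1]|x01] := boolP (0 <= x <= 1); last first.
  rewrite mule0 mul0e (_ : [set _ | _] = set0) ?measure0//.
  apply/seteqP; split=> // z [] /=; rewrite tnth_cons0 => x1 /(_ 0); rewrite tnth_cons0.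
  by move=> /(le_trans (normr_ge0 _)) x_ge0 _; rewrite x_ge0 x1 in x01.
have x_gt0 : 0 < x by rewrite lt_def x0.
rewrite mule1 (_ : x ^+ m = `|\det (x^-1%:M : 'M[R]_m)|^-1); last first.
  by rewrite det_scalar normrX normfV exprVn invrK gtr0_norm.
rewrite -(lebesgueRn_affine 0)//; last 2 first.
- by rewrite unitmxE det_scalar unitfE expf_neq0 ?invr_eq0.
- exact: measurable_slab.
congr (lam m _).
have tE z i : tnth (affine (x^-1%:M) 0 z) i = tnth z i / x.
  by rewrite tnth_mktuple addr0 mul_mx_scalar !mxE mulrC.
have scale_le (u h' : R) : (- h' <= u / x <= h') = (`|u| <= h' * x).
  by rewrite -ler_norml normrM normfV (gtr0_norm x_gt0) ler_pdivrMr.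
have formE z : affine_form (b 0 0) (row_tail b) (affine (x^-1%:M) 0 z) =
    affine_form 0 b (cons_pair (x, z)) / x.
  rewrite affine_form_cons add0r /affine_form mulrDl mulrAC divff// mul1r mulr_suml.
  by congr (_ + _); apply: eq_bigr => i _; rewrite tE mulrAC.
apply/seteqP; split=> z.
  move=> [] /=; rewrite tnth_cons0 => _ zx bz; split=> /= [i|]; last first.
    by rewrite formE scale_le.
  by rewrite tE scale_le mul1r; have := zx (lift 0 i); rewrite tnth_consS.
move=> [] /= zx; rewrite formE scale_le => bz; split; rewrite ?tnth_cons0// => i.
case: (unliftP 0 i) => [j ->|->]; last by rewrite tnth_cons0 gtr0_norm.
by rewrite tnth_consS; have := zx j; rewrite tE scale_le mul1r.
Qed.

Lemma integral_exprn01 m :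
  (\int[leb]_(x in `[0%R, 1%R]) (x ^+ m)%:E = (m.+1%:R^-1 : R)%:E)%E.
Proof.
have cX : {within `[0 : R, 1], continuous (fun x : R => x ^+ m)}.
  by apply: continuous_in_subspaceT => x _; exact: exprn_continuous.
transitivity ((\int[leb]_(x in `[0, 1]) x ^+ m : R)%R%:E).
  rewrite /Rintegral fineK//; apply: integrable_fin_num => //.
  exact: continuous_compact_integrable (@segment_compact _ _ _) cX.
rewrite Rintegration_by_substitution_onem ?ler01 ?lexx//.
rewrite -Rintegral_onemXn; congr ((Rintegral _ _ _)%:E).
by rewrite (_ : unstable.onem 1 = 0)//; exact: subrr.
Qed.

(** The factor is the integral of [x ^+ m] over [[0, 1]], the usual one over the dimension for a
    cone. *)
Lemma lebesgueRn_slab_cone m (b : 'rV[R]_m.+1) (h : R) :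
  (lam m.+1 (slab_cone b h) =
   (m.+1%:R^-1)%:E * lam m (slab (b 0 0)%R (row_tail b) h))%E.
Proof.
have mS := @measurable_slab_cone m b h.
rewrite lebesgueRnS; set W := lam m (slab _ _ _).
have W_ge0 : (0 <= W)%E by exact: measure_ge0.
have mX : measurable_fun setT (fun x : T => (x ^+ m)%:E).
  by apply/measurable_EFinP; exact: exprn_measurable.
have m1 : measurable_fun setT (fun x : T => (\1_`[0%R, 1%R] x)%:E : \bar R).
  by apply/measurable_EFinP; exact: measurable_indic.
rewrite (@ae_eq_integral _ _ _ _ _
  (fun x : T => (x ^+ m)%:E * (\1_`[0%R, 1%R] x)%:E * W)%E)//; last 3 first.
- exact: measurable_lebesgueRn_section.
- apply: emeasurable_funM => //; exact: emeasurable_funM.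
- exists [set (0 : T)]; split; [exact: measurable_set1|exact: lebesgue_measure_set1|].
  move=> x /=; apply: contra_notP => /eqP x0 _; exact: slab_cone_section.
rewrite ge0_integralZr//.
- by rewrite -integral_exprn01 [in RHS]integral_mkcond epatch_indic.
- exact: emeasurable_funM.
- move=> x _; rewrite indicE mem_setE/= in_itv/=.
  case: (boolP (0 <= x <= 1)) => [/andP[x0 _]|_]; last by rewrite mule0.
  by rewrite mule1 lee_fin exprn_ge0.
Qed.

Lemma hvol_cone m (a : 'rV[R]_m.+2) (s : {perm 'I_m.+2}) :
  usphere a -> a 0 (s 0) != 0 ->
  (hvol a (convex_hull ([set 0] `|` (facet (s (lift 0 0)) `&` hyperplane a))%R) =
   (`|a 0 (s 0)%R|^-1 / m.+1%:R)%:E *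
   lam m (slab (a 0 (s (lift 0 0)))
     (\row_i a 0 (s (lift 0 (lift 0 i)))) `|a 0 (s 0)|)%R)%E.
Proof.
move=> a1 as0; rewrite convex_hull_facet.
pose b : 'rV[R]_m.+1 := \row_i a 0 (s (lift 0 i)).
have bE t : \sum_j tnth t j * a 0 (s (lift 0 j)) = affine_form 0 b t.
  by rewrite /affine_form add0r; apply: eq_bigr => i _; rewrite mxE.
have as_gt0 : 0 < `|a 0 (s 0)| by rewrite normr_gt0.
set A := [set x | _].
have AE : [set t | A (hyperplane_point a s t)] = slab_cone b `|a 0 (s 0)|.
  have headE (t : m.+1.-tuple T) (h : R) : `|hyperplane_point a s t 0 (s 0)| <= h =
      (`|affine_form 0 b t| <= `|a 0 (s 0)| * h).
    rewrite hyperplane_point_head bE normrM normrN normfV ler_pdivrMr//.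
    by rewrite mulrC.
  apply/seteqP; split => t; rewrite /A /slab_cone/= hyperplane_point_tail.
    move=> [_ [t1 /(forall_perm s)[h0 ht]]]; rewrite headE in h0; split=> // i.
    by have := ht i; rewrite hyperplane_point_tail.
  move=> [t1 ht bt]; split; first exact: dotp_hyperplane_point.
  split=> //; apply/(forall_perm s); split=> [|i]; first by rewrite headE.
  by rewrite hyperplane_point_tail.
rewrite (@hvolE _ _ a s)// AE; last exact: measurable_slab_cone.
rewrite lebesgueRn_slab_cone muleA -EFinM; congr (_ * lam m (slab _ _ _))%E.
  by rewrite mxE.
by apply/rowP => i; rewrite !mxE.
Qed.

Lemma hvol_section N (a : 'rV[R]_N.+1) (s : {perm 'I_N.+1}) :
  usphere a -> a 0 (s 0) != 0 ->
  (hvol a (@cube R N.+1 `&` hyperplane a) =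
   (`|a 0 (s 0)%R|^-1)%:E *
   lam N (slab 0 (\row_i a 0 (s (lift 0 i))) `|a 0 (s 0)|)%R)%E.
Proof.
move=> a1 as0.
pose b : 'rV[R]_N := \row_i a 0 (s (lift 0 i)).
have bE t : \sum_j tnth t j * a 0 (s (lift 0 j)) = affine_form 0 b t.
  by rewrite /affine_form add0r; apply: eq_bigr => i _; rewrite mxE.
have as_gt0 : 0 < `|a 0 (s 0)| by rewrite normr_gt0.
set A := _ `&` _.
have AE : [set t | A (hyperplane_point a s t)] = slab 0 b `|a 0 (s 0)|.
  have headE (t : N.-tuple T) : -1 <= hyperplane_point a s t 0 (s 0) <= 1 =
      (- `|a 0 (s 0)| <= affine_form 0 b t <= `|a 0 (s 0)|).
    rewrite hyperplane_point_head bE -!ler_norml normrM normrN normfV.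
    by rewrite ler_pdivrMr// mul1r.
  apply/seteqP; split => t; rewrite /A /slab/=.
    move=> [/(forall_perm s)[h0 ht] _]; rewrite headE in h0; split=> // i.
    by have := ht i; rewrite hyperplane_point_tail.
  move=> [ht bt]; split; last exact: dotp_hyperplane_point.
  apply/(forall_perm s); split=> [|i]; first by rewrite headE.
  by rewrite hyperplane_point_tail.
rewrite (@hvolE _ _ a s)// AE//; exact: measurable_slab.
Qed.

Lemma lebesgueRn_slab_head0 m (b : 'rV[R]_m.+1) (c h : R) : b 0 0 = 0 ->
  (lam m.+1 (slab c b h) = 2%:E * lam m (slab c (row_tail b) h))%E.
Proof.
move=> b0; rewrite (@lebesgueRn_setX _ _ `[-1, 1]%classic (slab c (row_tail b) h))//.
- congr (_ * _)%E; rewrite lebesgue_measure_itv/= lte_fin gtrN ?ltr01//.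
  by rewrite -EFinD opprK.
- exact: measurable_slab.
- move=> x t; rewrite /slab/= qcube_cons in_itv/= affine_form_cons b0 mulr0 addr0.
  by split=> [[[? ?] ?]|[? [? ?]]].
Qed.

End cones.

(** * Mean absolute values of affine forms on the cube *)

Section cube_integrals.
Context (R : realType).
Local Notation T := (measurableTypeR R).
Local Notation leb := (@lebesgue_measure R).
Local Notation lam := (lebesgueRn R).

Lemma lebesgue_measure_itvI (p q : R) : p < q ->
  leb [set x : T | -1 <= x <= 1 /\ p <= x <= q] =
  ((`|1 - p| + `|1 + q| - `|1 + p| - `|q - 1|) / 2)%:E.
Proof.
move=> pq; rewrite (_ : [set _ | _] = `[Num.max (-1) p, Num.min 1 q]%classic); last first.
  apply/seteqP; split => x /=; rewrite in_itv/= ge_max le_min.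
    by move=> [/andP[-> ->] /andP[-> ->]].
  by move=> /andP[/andP[-> ->] /andP[-> ->]].
rewrite lebesgue_measure_itv/= lte_fin -EFinD -(fun_if EFin); congr EFin.
case: (leP (-1) p) => ?; case: (leP 1 q) => ?; case: ltP => ?;
  do 4 (case: (ler0P) => ?); lra.
Qed.

(** As a function of [w] this length is a trapezoid, and the four absolute values sit at its four
    kinks. *)
Lemma lebesgue_measure_slab1 (h b w : R) : 0 < h -> b != 0 ->
  leb [set x : T | -1 <= x <= 1 /\ - h <= x * b + w <= h] =
  ((`|h + b + w| + `|h + b - w| - `|h - b + w| - `|h - b - w|) / (2 * b))%:E.
Proof.
move=> h0; wlog b_gt0 : b / 0 < b => [th b0|_].
  have [b_gt0|b_lt0|/esym/eqP] := ltgtP 0 b; first exact: th; last first.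
    by rewrite (negbTE b0).
  (* A negative [b] is reduced to [- b] by the reflection [x |-> - x] of [[-1, 1]]. *)
  have := th (- b); rewrite oppr_gt0 oppr_eq0 => /(_ b_lt0 b0) E.
  pose S := [set x : T | -1 <= x <= 1 /\ - h <= x * - b + w <= h].
  have mS : measurable S.
    have mf : measurable_fun setT (fun x : T => x * - b + w : T).
      by apply: measurable_funD => //; apply: measurable_funM.
    rewrite (_ : S = [set x : T | -1 <= x] `&` [set x : T | x <= 1] `&`
      [set x : T | - h <= x * - b + w] `&` [set x : T | x * - b + w <= h]).
      apply: measurableI; [apply: measurableI; first apply: measurableI|].
      - exact: (@measurable_le_set _ _ _ (cst (-1)) id).
      - exact: (@measurable_le_set _ _ _ id (cst 1)).
      - exact: (@measurable_le_set _ _ _ (cst (- h)) _).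
      - exact: (@measurable_le_set _ _ _ _ (cst h)).
    by apply/seteqP; split=> x; rewrite /S/=; [move=> [/andP[? ?] /andP[? ?]]|
      move=> [[[? ?] ?] ?]; split; apply/andP].
  rewrite [in LHS](_ : [set x | _] = [set x : T | S (x * -1 + 0)]).
    rewrite lebesgue_measure_affine ?oppr_eq0 ?oner_eq0// E normrN1 invr1 mul1e.
    by congr EFin; rewrite !opprK; field; rewrite ?oppr_eq0 b0.
  by apply/seteqP; split=> x; rewrite /S/= addr0 mulrN1 mulrNN -!ler_norml normrN.
have E : [set x : T | -1 <= x <= 1 /\ - h <= x * b + w <= h] =
  [set x : T | -1 <= x <= 1 /\ (- h - w) / b <= x <= (h - w) / b].
  by apply/seteqP; split => x /=; rewrite ler_pdivrMr// ler_pdivlMr// lerBlDr lerBrDr.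
rewrite E lebesgue_measure_itvI; last by rewrite ltr_pM2r ?invr_gt0//; lra.
congr EFin.
have nE (u v : R) : u = v / b -> `|u| = `|v| / b.
  by move=> ->; rewrite normrM normfV (gtr0_norm b_gt0).
rewrite (nE (1 - (- h - w) / b) (h + b + w)); last by field; rewrite gt_eqF.
rewrite (nE (1 + (h - w) / b) (h + b - w)); last by field; rewrite gt_eqF.
rewrite (nE (1 + (- h - w) / b) (- (h - b + w))); last by field; rewrite gt_eqF.
rewrite (nE ((h - w) / b - 1) (h - b - w)); last by field; rewrite gt_eqF.
by rewrite normrN; field; rewrite gt_eqF.
Qed.

Lemma integrable_qcube m (f : m.-tuple T -> T) (C : R) : measurable_fun setT f ->
  (forall z, qcube z -> `|f z| <= C) -> (lam m).-integrable (@qcube R m) (EFin \o f).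
Proof.
move=> mf fC; apply: measurable_bounded_integrable.
- exact: measurable_qcube.
- by have := @lebesgueRn_qcubeI_lty R m setT measurableT; rewrite setIT.
- exact: measurable_funTS.
- exists C; split; first exact: num_real.
  by move=> x Cx z Qz /=; rewrite (le_trans (fC _ Qz))// ltW.
Qed.

Lemma affine_form_bound m c (v : 'rV[R]_m) z : qcube z ->
  `|affine_form c v z| <= `|c| + \sum_i `|v 0 i|.
Proof.
move=> Qz; rewrite (le_trans (ler_normD _ _))// lerD2l.
rewrite (le_trans (ler_norm_sum _ _ _))// ler_sum// => i _.
by rewrite normrM ler_piMl// ler_norml Qz.
Qed.

(** Sign changes of coordinates, encoded as an affine map so that invariance of the measure is an
    instance of [lebesgueRn_affine]. *)
Definition flip m (e : 'I_m -> bool) : m.-tuple T -> m.-tuple T :=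
  affine (diag_mx (\row_i (-1) ^+ e i)) 0.

Lemma tnth_flip m (e : 'I_m -> bool) z i :
  tnth (flip e z) i = (-1) ^+ e i * tnth z i.
Proof.
rewrite tnth_mktuple addr0 mxE (bigD1 i)//= big1 => [|j ji]; last first.
  by rewrite !mxE (negbTE ji) mulr0.
by rewrite !mxE eqxx mulr1n addr0 mulrC.
Qed.

Lemma det_flip m (e : 'I_m -> bool) :
  `|\det (diag_mx (\row_i (-1) ^+ e i) : 'M[R]_m)| = 1.
Proof.
by rewrite det_diag normr_prod big1// => i _; rewrite mxE normr_sign.
Qed.

Lemma qcube_flip m (e : 'I_m -> bool) (z : m.-tuple T) :
  qcube (flip e z) <-> qcube z.
Proof.
by split=> Qz i; have := Qz i; rewrite tnth_flip -!ler_norml normrMsign.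
Qed.

Lemma Rintegral_qcube_flip m (e : 'I_m -> bool) (f : m.-tuple T -> T) :
  measurable_fun setT f ->
  \int[lam m]_(z in @qcube R m) f (flip e z) = \int[lam m]_(z in @qcube R m) f z.
Proof.
move=> mf; congr fine.
have mflip : measurable_fun setT (flip e) by exact: measurable_affine.
pose g := (EFin \o f) \_ (@qcube R m).
have mg : measurable_fun setT g.
  apply/(measurable_restrictT _ (@measurable_qcube R m)).
  by apply: measurable_funTS; exact/measurable_EFinP.
(* The change of variables holds for nonnegative functions, so it is applied to the positive and
   negative parts of [f] extended by 0 outside the cube. *)
have ge0 (k : m.-tuple T -> \bar R) : measurable_fun setT k ->
    (forall z, 0 <= k z)%E ->
    (\int[lam m]_z k (flip e z) = \int[lam m]_z k z)%E.
  move=> mk k0.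
  rewrite (@ge0_integral_scaled_pushforward _ _ _ (lam m) (flip e) 1%:nng k)//=.
    by rewrite mul1e.
  move=> S mS; rewrite lebesgueRn_affine// ?det_flip ?invr1//.
  by rewrite unitmxE unitfE -normr_eq0 det_flip oner_eq0.
rewrite [RHS]integral_mkcond -/g [RHS]integralE.
rewrite -ge0//; last exact: measurable_funepos.
rewrite -[X in (_ - X)%E]ge0//; last exact: measurable_funeneg.
rewrite [LHS]integral_mkcond.
transitivity (\int[lam m]_z (g (flip e z)))%E; last first.
  by rewrite [LHS]integralE; congr (_ - _)%E; apply: eq_integral => z _;
    rewrite ?funeposE ?funenegE.
apply: eq_integral => z _; rewrite /g !patchE.
by rewrite (_ : (flip e z \in @qcube R m) = (z \in @qcube R m))//;
  apply/idP/idP; rewrite !inE => /qcube_flip.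
Qed.

End cube_integrals.

(** * The function [Phi], its partial derivatives and their symmetries *)

Section abs_mean.
Context (R : realType).
Local Notation T := (measurableTypeR R).
Local Notation leb := (@lebesgue_measure R).
Local Notation lam := (lebesgueRn R).

(** This is [Phi], left unnormalised: the integral is not divided by [2 ^+ m]. *)
Definition abs_mean m (c : R) (v : 'rV[R]_m) : R :=
  \int[lam m]_(z in @qcube R m) `|affine_form c v z|.

(** [sgn_mean] and [sgn_moment] are the partial derivatives of [abs_mean] in [c] and in [v 0 i],
    wherever [(c, v)] is nonzero. *)
Definition sgn_mean m (c : R) (v : 'rV[R]_m) : R :=
  \int[lam m]_(z in @qcube R m) Num.sg (affine_form c v z).

Definition sgn_moment m (c : R) (v : 'rV[R]_m) i : R :=
  \int[lam m]_(z in @qcube R m) (Num.sg (affine_form c v z) * tnth z i).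

Definition abs_mean_diff m (c : R) (v : 'rV[R]_m) (c' : R) (v' : 'rV[R]_m) : R :=
  sgn_mean c v * c' + \sum_i sgn_moment c v i * v' 0 i.

Lemma measurable_sgr : measurable_fun setT (Num.sg : T -> T).
Proof.
rewrite (_ : Num.sg = fun x : T => if 0 < x then 1 else if x < 0 then -1 else 0 : T).
  apply: measurable_fun_ifT => //; first exact: measurable_fun_ltr.
  by apply: measurable_fun_ifT => //; exact: measurable_fun_ltr.
by apply/funext => x; case: sgrP.
Qed.

Lemma measurable_sg_form m c (v : 'rV[R]_m) :
  measurable_fun setT (fun z => Num.sg (affine_form c v z) : T).
Proof. by apply: (measurableT_comp measurable_sgr); exact: measurable_affine_form. Qed.

Lemma integrable_abs_form m c (v : 'rV[R]_m) :
  (lam m).-integrable (@qcube R m) (EFin \o (fun z => `|affine_form c v z|)).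
Proof.
apply: integrable_qcube.
  by apply: measurable_norm_comp; exact: measurable_affine_form.
by move=> z Qz; rewrite normr_id; exact: affine_form_bound.
Qed.

Lemma integrable_sg_form m c (v : 'rV[R]_m) :
  (lam m).-integrable (@qcube R m) (EFin \o (fun z => Num.sg (affine_form c v z) : T)).
Proof.
apply: (@integrable_qcube _ _ _ 1); first exact: measurable_sg_form.
by move=> z _; rewrite normr_sg lern1 leq_b1.
Qed.

Lemma integrable_sg_form_coord m c (v : 'rV[R]_m) i :
  (lam m).-integrable (@qcube R m)
    (EFin \o (fun z => Num.sg (affine_form c v z) * tnth z i : T)).
Proof.
apply: (@integrable_qcube _ _ _ 1).
  by apply: measurable_funM; [exact: measurable_sg_form|exact: measurable_tnth].
move=> z Qz; rewrite normrM mulr_ile1// ?normr_sg ?lern1 ?leq_b1//.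
by rewrite ler_norml Qz.
Qed.

Lemma integrable_sg_form_mul m c (v : 'rV[R]_m) c' v' :
  (lam m).-integrable (@qcube R m)
    (EFin \o (fun z => Num.sg (affine_form c v z) * affine_form c' v' z : T)).
Proof.
apply: (@integrable_qcube _ _ _ (`|c'| + \sum_i `|v' 0 i|)).
  by apply: measurable_funM; [exact: measurable_sg_form|exact: measurable_affine_form].
move=> z Qz; rewrite normrM (le_trans _ (affine_form_bound c' v' Qz))//.
by rewrite ler_piMl// normr_sg lern1 leq_b1.
Qed.

Lemma Rintegral_sum m k (f : 'I_k -> m.-tuple T -> R) :
  (forall i, (lam m).-integrable (@qcube R m) (EFin \o f i)) ->
  \int[lam m]_(z in @qcube R m) (\sum_i f i z) =
  \sum_i \int[lam m]_(z in @qcube R m) f i z.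
Proof.
have mQ := @measurable_qcube R m.
elim: k f => [|k IHk] f fi.
  under eq_Rintegral do rewrite big_ord0.
  by rewrite big_ord0 /Rintegral integral0.
under eq_Rintegral do rewrite big_ord_recl.
rewrite RintegralD//; first by rewrite IHk// big_ord_recl.
rewrite (_ : EFin \o _ = fun z => (\sum_i (f (lift ord0 i) z)%:E)%E).
  apply: (@integrable_sum _ _ _ (lam m) _ mQ _ _ xpredT
    (fun i z => (f (lift ord0 i) z)%:E)) => i _.
  exact: fi.
by apply/funext => z; rewrite /= sumEFin.
Qed.

Lemma abs_mean_diffE m c (v : 'rV[R]_m) c' v' :
  abs_mean_diff c v c' v' =
  \int[lam m]_(z in @qcube R m) (Num.sg (affine_form c v z) * affine_form c' v' z).
Proof.
have mQ := @measurable_qcube R m.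
have isg := integrable_sg_form c v; have isgz := integrable_sg_form_coord c v.
have E z : Num.sg (affine_form c v z) * affine_form c' v' z =
    c' * Num.sg (affine_form c v z) +
    \sum_i (v' 0 i * (Num.sg (affine_form c v z) * tnth z i)).
  rewrite {2}/affine_form mulrDr mulrC mulr_sumr; congr (_ + _).
  by apply: eq_bigr => i _; rewrite [RHS]mulrCA (mulrC (v' 0 i)).
have iZ (k : R) (f : m.-tuple T -> R) :
    (lam m).-integrable (@qcube R m) (EFin \o f) ->
    (lam m).-integrable (@qcube R m) (EFin \o (fun z => k * f z)).
  by move=> fi; have := integrableZl mQ k fi.
have isgv i : (lam m).-integrable (@qcube R m)
    (EFin \o (fun z => v' 0 i * (Num.sg (affine_form c v z) * tnth z i))).
  by apply: (iZ (v' 0 i)); exact: isgz.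
under [RHS]eq_Rintegral do rewrite E.
rewrite RintegralD//; last 2 first.
- by apply: (iZ c').
- rewrite (_ : _ \o _ = fun z => (\sum_i
      (v' 0 i * (Num.sg (affine_form c v z) * tnth z i))%:E)%E).
    apply: (@integrable_sum _ _ _ (lam m) _ mQ _ _ xpredT (fun i z =>
      (v' 0 i * (Num.sg (affine_form c v z) * tnth z i))%:E)) => i _.
    exact: isgv.
  by apply/funext => z; rewrite /= sumEFin.
rewrite RintegralZl// Rintegral_sum// mulrC; congr (_ + _).
by apply: eq_bigr => i _; rewrite RintegralZl// mulrC.
Qed.

(** Euler's identity for [Phi], which is homogeneous of degree 1. *)
Lemma abs_mean_diff_id m c (v : 'rV[R]_m) : abs_mean_diff c v c v = abs_mean c v.
Proof.
by rewrite abs_mean_diffE; apply: eq_Rintegral => z _; rewrite -normrEsg.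
Qed.

Lemma affine_form_oppr m c (v : 'rV[R]_m) z :
  affine_form c (- v) z = affine_form c v (flip (fun=> true) z).
Proof.
congr (_ + _); apply: eq_bigr => i _.
by rewrite tnth_flip mxE expr1 mulN1r mulrN mulNr.
Qed.

Lemma affine_formN m c (v : 'rV[R]_m) z :
  affine_form (- c) v z = - affine_form c (- v) z.
Proof.
rewrite /affine_form opprD -sumrN; congr (_ + _).
by apply: eq_bigr => i _; rewrite mxE mulrN opprK.
Qed.

Lemma abs_mean_oppr m c (v : 'rV[R]_m) : abs_mean c (- v) = abs_mean c v.
Proof.
rewrite [RHS](esym (Rintegral_qcube_flip (fun=> true) _)); last first.
  by apply: measurable_norm_comp; exact: measurable_affine_form.
by apply: eq_Rintegral => z _; rewrite affine_form_oppr.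
Qed.

Lemma abs_mean_oppl m c (v : 'rV[R]_m) : abs_mean (- c) v = abs_mean c v.
Proof.
rewrite -[RHS]abs_mean_oppr; apply: eq_Rintegral => z _.
by rewrite affine_formN normrN.
Qed.

Lemma sgn_mean_oppr m c (v : 'rV[R]_m) : sgn_mean c (- v) = sgn_mean c v.
Proof.
rewrite [RHS](esym (Rintegral_qcube_flip (fun=> true) _)); last first.
  exact: measurable_sg_form.
by apply: eq_Rintegral => z _; rewrite affine_form_oppr.
Qed.

Lemma sgn_mean_oppl m c (v : 'rV[R]_m) : sgn_mean (- c) v = - sgn_mean c v.
Proof.
have mQ := @measurable_qcube R m.
rewrite -[in RHS]sgn_mean_oppr -[RHS]mulN1r [in RHS]/sgn_mean -RintegralZl//; last exact: integrable_sg_form.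
by apply: eq_Rintegral => z _; rewrite affine_formN sgrN mulN1r.
Qed.

(** The integrand is odd in the [i]-th coordinate. Hence the gradient vanishes wherever [a] has a
    zero coordinate. *)
Lemma sgn_moment_eq0 m c (v : 'rV[R]_m) i : v 0 i = 0 -> sgn_moment c v i = 0.
Proof.
move=> vi0; pose f z := Num.sg (affine_form c v z) * tnth z i : T.
have mf : measurable_fun setT f.
  by apply: measurable_funM; [exact: measurable_sg_form|exact: measurable_tnth].
have mQ := @measurable_qcube R m.
suff : sgn_moment c v i = - sgn_moment c v i by lra.
rewrite -[RHS]mulN1r [in RHS]/sgn_moment -RintegralZl//; last exact: integrable_sg_form_coord.
rewrite -[LHS](Rintegral_qcube_flip (fun j => j == i) mf).
apply: eq_Rintegral => z _; rewrite /f tnth_flip eqxx expr1 mulN1r mulrN mulN1r.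
congr (- (Num.sg (_ + _) * _)); apply: eq_bigr => j _.
by rewrite tnth_flip; case: eqVneq => [->|_]; rewrite ?vi0 ?mulr0// expr0 mul1r.
Qed.

End abs_mean.

(** * Differentiability of [Phi], and slab volumes through [Phi] and its derivative *)

Section abs_mean_volume.
Context (R : realType).
Local Notation T := (measurableTypeR R).
Local Notation leb := (@lebesgue_measure R).
Local Notation lam := (lebesgueRn R).

Lemma Rintegral_indic_qcube m (S : set (m.-tuple T)) : measurable S ->
  \int[lam m]_(z in @qcube R m) \1_S z = fine (lam m (@qcube R m `&` S)).
Proof.
move=> mS; rewrite /Rintegral integral_indic//; first by rewrite setIC.
exact: measurable_qcube.
Qed.

(** If [|u| > d], then [u] and [u + w] have the same sign and the expansion is exact. Otherwise the
    two parts of the remainder are at most [d] each. *)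
Lemma norm_sg_approx (u w d : R) : `|w| <= d ->
  `| `|u + w| - `|u| - Num.sg u * w| <= 2 * d * (`|u| <= d)%R%:R.
Proof.
move=> wd; have wd' : - d <= w <= d by rewrite -ler_norml.
case/andP: wd' => ? ?.
have [ud|ud] := leP `|u| d; rewrite ?mulr1 ?mulr0.
  have usg : `|Num.sg u * w| <= d.
    by rewrite normrM (le_trans _ wd)// ler_piMl// normr_sg lern1 leq_b1.
  rewrite (le_trans (ler_normB _ _))// mulr_natl mulr2n lerD//.
  by rewrite (le_trans (ler_dist_dist _ _))// addrC addKr.
rewrite normr_le0; apply/eqP; move: ud; case: (sgrP u) => [->|u0|u0].
- by lra.
- by move=> ud; rewrite gtr0_norm; lra.
- by move=> ud; rewrite ltr0_norm; lra.
Qed.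

(** With [l] the size of the increment, the remainder is at most [2 * l] and lives on the slab where
    the form is at most [l]. Once [l <= d], that slab has measure at most [e / 2]. *)
Lemma abs_mean_differentiable m (c : R) (v : 'rV[R]_m) (e : R) :
  (c != 0) || (v != 0) -> 0 < e ->
  exists2 d, 0 < d & forall (c' : R) (v' : 'rV[R]_m), `|c'| + \sum_i `|v' 0 i| <= d ->
    `|abs_mean (c + c') (v + v') - abs_mean c v - abs_mean_diff c v c' v'|
      <= e * (`|c'| + \sum_i `|v' 0 i|).
Proof.
move=> cv e0; have mQ := @measurable_qcube R m.
have e2 : 0 < e / 2 by rewrite divr_gt0.
have [d d0 slabd] := qcube_slab_small cv e2; exists d => // c' v'.
set l := _ + _ => ld; have l0 : 0 <= l by rewrite addr_ge0// sumr_ge0.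
have addE z : affine_form (c + c') (v + v') z = affine_form c v z + affine_form c' v' z.
  rewrite /affine_form addrACA -big_split; congr (_ + _).
  by apply: eq_bigr => i _; rewrite mxE mulrDr.
have i1 := integrable_abs_form (c + c') (v + v').
have i2 := integrable_abs_form c v.
have i3 := integrable_sg_form_mul c v c' v'.
pose S := [set z : m.-tuple T | `|affine_form c v z| <= l].
have mS : measurable S.
  apply: (@measurable_le_set _ _ _ _ (cst l)) => //.
  by apply: measurable_norm_comp; exact: measurable_affine_form.
have i12 : (lam m).-integrable (@qcube R m) (EFin \o (fun z =>
    `|affine_form (c + c') (v + v') z| - `|affine_form c v z|)).
  by have := integrableB mQ i1 i2.
have i123 : (lam m).-integrable (@qcube R m) (EFin \o (fun z =>
    `|affine_form (c + c') (v + v') z| - `|affine_form c v z| -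
    Num.sg (affine_form c v z) * affine_form c' v' z)).
  by have := integrableB mQ i12 i3.
rewrite abs_mean_diffE /abs_mean -RintegralB// -RintegralB//.
rewrite (le_trans (le_normr_Rintegral mQ i123))//.
have iS : (lam m).-integrable (@qcube R m) (EFin \o (\1_S : m.-tuple T -> T)).
  apply: (@integrable_qcube _ _ _ 1); first exact: measurable_indic.
  by move=> z _; rewrite indicE ger0_norm// lern1 leq_b1.
apply: (@le_trans _ _ (\int[lam m]_(z in @qcube R m) (2 * l * \1_S z))).
  apply: le_Rintegral => //.
  - exact: integrable_norm.
  - by have := integrableZl mQ (2 * l) iS.
  - move=> z Qz; rewrite addE indicE mem_setE; apply: norm_sg_approx.
    exact: affine_form_bound.
rewrite RintegralZl// Rintegral_indic_qcube//.
have : fine (lam m (@qcube R m `&` S)) <= e / 2.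
  rewrite -lee_fin fineK; last by rewrite ge0_fin_numE// lebesgueRn_qcubeI_lty.
  apply: le_trans (ltW slabd); apply: le_measure; rewrite ?inE.
  - exact: measurableI.
  - exact: measurable_slab.
  - by move=> z [Qz Sz]; split => //=; rewrite -ler_norml (le_trans Sz).
by move=> /(ler_wpM2l (mulr_ge0 (ler0n R 2) l0)) /le_trans; apply; rewrite le_eqVlt; apply/orP; left; apply/eqP; field.
Qed.

(** Where [u] is the value of the form, twice the indicator of [|u| <= h] is
    [sgn (h + u) + sgn (h - u)] except at [u = h] or [u = - h]. The hypotheses make these two sets
    null. Flipping all coordinates turns the second mean into [sgn_mean (h - c) v]. *)
Lemma slab_volume m (c : R) (v : 'rV[R]_m) (h : R) : 0 < h ->
  (h + c != 0) || (v != 0) -> (h - c != 0) || (v != 0) ->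
  2 * fine (lam m (slab c v h)) = sgn_mean (h + c) v + sgn_mean (h - c) v.
Proof.
move=> h0 hp hm; have mQ := @measurable_qcube R m.
rewrite -[sgn_mean (h - c) v]sgn_mean_oppr -RintegralD//; last 2 first.
- exact: integrable_sg_form.
- exact: integrable_sg_form.
pose S := [set z : m.-tuple T | - h <= affine_form c v z <= h].
have mS : measurable S by exact: measurable_affine_form_itv.
rewrite /slab -/S -Rintegral_indic_qcube// -RintegralZl//; last first.
  apply: (@integrable_qcube _ _ (\1_S) 1); first exact: measurable_indic.
  by move=> z _; rewrite indicE ger0_norm// lern1 leq_b1.
congr fine; apply: ae_eq_integral => //.
- by apply/measurable_EFinP; apply: measurable_funM.
- apply/measurable_EFinP; apply: measurable_funD.
  + by apply: measurable_funTS; exact: measurable_sg_form.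
  + by apply: measurable_funTS; exact: measurable_sg_form.
have addE k z : affine_form (h + k) v z = h + affine_form k v z.
  by rewrite /affine_form addrA.
have E1 z : affine_form (h + c) v z = h + affine_form c v z by rewrite addE.
have E2 z : affine_form (h - c) (- v) z = h - affine_form c v z.
  by rewrite /affine_form opprD addrA -sumrN; congr (_ + _); apply: eq_bigr => i _;
    rewrite mxE mulrN.
have m0 k (w : 'rV[R]_m) : measurable [set z | affine_form k w z = 0].
  rewrite (_ : [set _ | _] = [set z | 0 <= affine_form k w z <= 0]).
    exact: measurable_affine_form_itv.
  by apply/seteqP; split => t /=; rewrite -eq_le eq_sym => /eqP.
exists ([set z | affine_form (h + c) v z = 0] `|` [set z | affine_form (h - c) (- v) z = 0]).
split.
- exact: measurableU.
- apply/eqP; rewrite eq_le measure_ge0 andbT.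
  rewrite (le_trans (measureU2 _ _ _))//.
  rewrite [X in (X + _ <= _)%E](_ : _ = 0%E); last exact: lebesgueRn_affine_form_eq0.
  rewrite add0e [X in (X <= _)%E](_ : _ = 0%E)//.
  by apply: lebesgueRn_affine_form_eq0; rewrite oppr_eq0.
- move=> z /=; apply: contra_notP => /not_orP[]; rewrite E1 E2 => z1 z2 Qz.
  rewrite /= indicE; congr EFin; set u := affine_form c v z in z1 z2 *.
  have -> : (z \in S) = (- h <= u <= h) by apply/idP/idP; rewrite inE.
  have [p|p|//] := ltgtP (h + u) 0; have [q|q|//] := ltgtP (h - u) 0.
  - by lra.
  - rewrite (ltr0_sg p) (gtr0_sg q) (_ : _ <= _ <= _ = false); first by rewrite /= mulr0n; lra.
    by apply/negbTE; rewrite negb_and -ltNge; apply/orP; left; lra.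
  - rewrite (gtr0_sg p) (ltr0_sg q) (_ : _ <= _ <= _ = false); first by rewrite /= mulr0n; lra.
    by apply/negbTE; rewrite negb_and -!ltNge; apply/orP; right; lra.
  - rewrite (gtr0_sg p) (gtr0_sg q) (_ : _ <= _ <= _ = true); first by rewrite /= mulr1n; lra.
    by apply/andP; split; lra.
Qed.

(** Integrating the head first gives the trapezoid with its four absolute values. The symmetry of
    the cube pairs them off, which cancels the factor 2. *)
Lemma section_volume m (b : 'rV[R]_m.+1) (h : R) : 0 < h -> b 0 0 != 0 ->
  b 0 0 * fine (lam m.+1 (slab 0 b h)) =
  abs_mean (h + b 0 0) (row_tail b) - abs_mean (h - b 0 0) (row_tail b).
Proof.
move=> h0 b0; have mQ := @measurable_qcube R m.
set v := row_tail b; set b0' := b 0 0 in b0 *.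
pose L z := (`|affine_form (h + b0') v z| + `|affine_form (h + b0') (- v) z| -
  `|affine_form (h - b0') v z| - `|affine_form (h - b0') (- v) z|) / (2 * b0').
have -> : fine (lam m.+1 (slab 0 b h)) = \int[lam m]_(z in @qcube R m) L z.
  rewrite lebesgueRnS_swap; last exact: measurable_slab.
  congr fine; rewrite [RHS]integral_mkcond; apply: eq_integral => z _.
  rewrite patchE; have [Qz|Qz] := pselect (qcube z); last first.
    rewrite (memNset Qz).
    rewrite (_ : [set _ | _] = set0) ?measure0//; apply/seteqP; split => // x /=.
    by rewrite /slab/= qcube_cons => -[[]].
  rewrite (mem_set Qz); pose w := \sum_i tnth z i * v 0 i.
  have fE k : affine_form k v z = k + w by [].
  have fE' k : affine_form k (- v) z = k - w.
    by rewrite /affine_form -sumrN; congr (_ + _); apply: eq_bigr => i _;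
      rewrite mxE mulrN.
  rewrite /L !fE !fE' -lebesgue_measure_slab1//; congr leb.
  apply/seteqP; split => x /=; rewrite /slab/= qcube_cons affine_form_cons fE add0r.
    by move=> [[? _] ?].
  by move=> [? ?].
have ia k := integrable_abs_form k v; have ia' k := integrable_abs_form k (- v).
have i2 := integrableD mQ (ia (h + b0')) (ia' (h + b0')).
have i3 := integrableB mQ i2 (ia (h - b0')).
have i4 := integrableB mQ i3 (ia' (h - b0')).
rewrite -RintegralZl//; last by have := integrableZr mQ (2 * b0')^-1 i4.
rewrite -[abs_mean (h + b0') v]mulr1 -[abs_mean (h - b0') v]mulr1.
transitivity (2^-1 * (abs_mean (h + b0') v + abs_mean (h + b0') (- v) -
    abs_mean (h - b0') v - abs_mean (h - b0') (- v))); last first.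
  by rewrite !abs_mean_oppr; field.
rewrite /abs_mean -RintegralD// -RintegralB// -RintegralB// -RintegralZl//.
by apply: eq_Rintegral => z _; rewrite /L; field.
Qed.

End abs_mean_volume.

(** * Section and cone volumes as means of affine forms *)

Section volume_formulas.
Context (R : realType).
Local Notation T := (measurableTypeR R).
Local Notation lam := (lebesgueRn R).
Variables (m : nat) (s : {perm 'I_m.+2}).

Definition row_tail2 (x : 'rV[R]_m.+2) : 'rV[R]_m :=
  \row_i x 0 (s (lift 0 (lift 0 i))).

Local Notation j := (s 0).
Local Notation k := (s (lift 0 0)).
Local Notation V a i := (fine (hvol a (convex_hull ([set 0] `|` (facet i `&` hyperplane a))))).

(** The signs of the two coordinates do not matter, because [abs_mean] is even in its constant
    term. *)
Lemma central_section_volumeE (x : 'rV[R]_m.+2) : usphere x ->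
  x 0 j != 0 -> x 0 k != 0 ->
  x 0 j * x 0 k * central_section_volume x =
  abs_mean (x 0 j + x 0 k) (row_tail2 x) - abs_mean (x 0 j - x 0 k) (row_tail2 x).
Proof.
move=> x1 xj xk; rewrite /central_section_volume (@hvol_section _ _ _ s)//.
rewrite fineM//; last exact: slab_fin_num.
set b := \row_i _; have bE : b 0 0 = x 0 k by rewrite mxE.
have tE : row_tail b = row_tail2 x by apply/rowP => i; rewrite !mxE.
have nx0 : 0 < `|x 0 j| by rewrite normr_gt0.
have := @section_volume R m b `|x 0 j| nx0; rewrite bE tE => /(_ xk) E.
rewrite [fine (_%:E)]/= -mulrA [X in _ * X]mulrCA E mulrA.
have [xj0|xj0|/eqP] := ltgtP (x 0 j) 0; last by rewrite (negbTE xj).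
  rewrite (ltr0_norm xj0) invrN mulrN mulfV// mulN1r opprB.
  rewrite -[abs_mean (- _ - _) _]abs_mean_oppl -[abs_mean (- _ + _) _]abs_mean_oppl.
  by rewrite !opprD !opprK.
by rewrite (gtr0_norm xj0) mulfV// mul1r.
Qed.

Lemma hvol_cone_fin (a : 'rV[R]_m.+2) : usphere a -> a 0 j != 0 ->
  hvol a (convex_hull ([set 0] `|` (facet k `&` hyperplane a))) = (V a k)%:E.
Proof.
by move=> a1 aj; rewrite fineK// hvol_cone// fin_numM// slab_fin_num.
Qed.

Lemma cone_volumeE (a : 'rV[R]_m.+2) : usphere a -> a 0 j != 0 ->
  V a k = `|a 0 j|^-1 / m.+1%:R * fine (lam m (slab (a 0 k) (row_tail2 a) `|a 0 j|)).
Proof.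
by move=> a1 aj; rewrite hvol_cone// fineM// slab_fin_num.
Qed.

(** The right-hand side is exactly what differentiating the two [Phi] terms in the [k]-th coordinate
    produces. For [a 0 j < 0], the oddness of [sgn_mean] in its constant term exchanges the two
    terms. *)
Lemma cone_volume_sgn_mean (a : 'rV[R]_m.+2) : usphere a -> a 0 j != 0 ->
  (a 0 j + a 0 k != 0) || (row_tail2 a != 0) ->
  (a 0 j - a 0 k != 0) || (row_tail2 a != 0) ->
  2 * m.+1%:R * a 0 j * V a k =
  sgn_mean (a 0 j + a 0 k) (row_tail2 a) + sgn_mean (a 0 j - a 0 k) (row_tail2 a).
Proof.
move=> a1 aj hp hm; rewrite cone_volumeE//.
have naj : 0 < `|a 0 j| by rewrite normr_gt0.
set W := fine _.
have : m.+1%:R != 0 :> R by rewrite pnatr_eq0.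
move: (m.+1%:R : R) => M M0.
have [aj0|aj0|/eqP] := ltgtP (a 0 j) 0; last by rewrite (negbTE aj).
  have E : 2 * W = sgn_mean (- a 0 j + a 0 k) (row_tail2 a) + sgn_mean (- a 0 j - a 0 k) (row_tail2 a).
    rewrite /W -(ltr0_norm aj0) slab_volume// (ltr0_norm aj0).
      by rewrite -oppr_eq0 opprD opprK.
    by rewrite -oppr_eq0 opprD !opprK.
  have -> : sgn_mean (a 0 j + a 0 k) (row_tail2 a) +
      sgn_mean (a 0 j - a 0 k) (row_tail2 a) = - (2 * W).
    rewrite E [in RHS](_ : - a 0 j + _ = - (a 0 j - a 0 k)); last by ring.
    by rewrite [in RHS](_ : - a 0 j - _ = - (a 0 j + a 0 k)) ?sgn_mean_oppl; ring.
  by rewrite (ltr0_norm aj0); field; rewrite aj M0.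
have E : 2 * W = sgn_mean (a 0 j + a 0 k) (row_tail2 a) + sgn_mean (a 0 j - a 0 k) (row_tail2 a).
  by rewrite /W slab_volume (gtr0_norm aj0).
by rewrite -E (gtr0_norm aj0); field; rewrite aj M0.
Qed.

(** Here the section is a prism of length 2 in direction [k], and the cone is a pyramid of height 1
    over the same base. *)
Lemma cone_volume_coord0 (a : 'rV[R]_m.+2) : usphere a -> a 0 j != 0 -> a 0 k = 0 ->
  2 * m.+1%:R * V a k = central_section_volume a.
Proof.
move=> a1 aj ak; rewrite cone_volumeE// /central_section_volume.
rewrite (@hvol_section _ _ _ s)// lebesgueRn_slab_head0 ?mxE// ak.
rewrite fineM//; last first.
  by rewrite fin_numM// slab_fin_num.
rewrite fineM//; last exact: slab_fin_num.
rewrite (_ : row_tail _ = row_tail2 a); last by apply/rowP => i; rewrite !mxE.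
have : m.+1%:R != 0 :> R by rewrite pnatr_eq0.
move: (m.+1%:R : R) => M M0.
by set W := fine (lam m _); rewrite /=; field; rewrite normr_eq0 aj M0.
Qed.

End volume_formulas.

(** * Tangential gradients *)

Section sphere_calculus.
Context (R : realType) (n : nat).
Implicit Types (a x y g u : 'rV[R]_n) (f : 'rV[R]_n -> R).

Lemma coord_le_norm x i : `|x 0 i| <= `|x|.
Proof.
rewrite [leRHS]mx_normrE.
exact: (le_bigmax _ (fun ij : 'I_1 * 'I_n => `|x ij.1 ij.2|) (0, i)).
Qed.

Lemma dotpBr g x y : dotp g (x - y) = dotp g x - dotp g y.
Proof. by rewrite -sumrB; apply: eq_bigr => i _; rewrite !mxE mulrBr. Qed.

Lemma dotpDr g x y : dotp g (x + y) = dotp g x + dotp g y.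
Proof. by rewrite -big_split; apply: eq_bigr => i _; rewrite !mxE mulrDr. Qed.

Lemma dotpZr g (c : R) x : dotp g (c *: x) = c * dotp g x.
Proof. by rewrite mulr_sumr; apply: eq_bigr => i _; rewrite !mxE mulrCA. Qed.

Lemma dotpBl g x y : dotp (x - y) g = dotp x g - dotp y g.
Proof. by rewrite dotpC dotpBr ![dotp g _]dotpC. Qed.

Lemma dotp_le g x : `|dotp g x| <= (\sum_i `|g 0 i|) * `|x|.
Proof.
rewrite (le_trans (ler_norm_sum _ _ _))// mulr_suml ler_sum// => i _.
by rewrite normrM ler_wpM2l// coord_le_norm.
Qed.

Definition sphere_small a f := forall e, 0 < e -> exists2 d, 0 < d &
  forall x, usphere x -> `|x - a| < d -> `|f x| <= e * `|x - a|.

Lemma sphere_gradientE f a g : sphere_gradient f a g <->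
  dotp g a = 0 /\ sphere_small a (fun x => f x - f a - dotp g (x - a)).
Proof.
split=> -[ga H]; split=> //.
  move=> e e0; move/eqoP : H => /(_ _ e0).
  rewrite near_withinE => /nbhs_normP[d /= d0 Hd]; exists d => // x x1 xd.
  by apply: Hd => //=; rewrite distrC.
apply/eqoP => e e0; have [d d0 Hd] := H e e0.
rewrite near_withinE.
apply: (nbhs_normP a (fun x => usphere x ->
  `|f x - f a - dotp g (x - a)| <= e * `|x - a|)).2.
exists d => // x /= xd x1.
by apply: Hd => //; rewrite distrC.
Qed.

Lemma sphere_small_eq a f1 f2 (d : R) : 0 < d ->
  (forall x, usphere x -> `|x - a| < d -> f1 x = f2 x) ->
  sphere_small a f1 -> sphere_small a f2.
Proof.
move=> d0 f12 sf e e0; have [d' d'0 H] := sf e e0.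
exists (Num.min d d'); first by rewrite lt_min d0.
by move=> x x1; rewrite lt_min => /andP[xd xd']; rewrite -f12//; exact: H.
Qed.

Lemma sphere_smallD a f1 f2 : sphere_small a f1 -> sphere_small a f2 ->
  sphere_small a (fun x => f1 x + f2 x).
Proof.
move=> s1 s2 e e0; have e2 : 0 < e / 2 by rewrite divr_gt0.
have [d1 d10 H1] := s1 _ e2; have [d2 d20 H2] := s2 _ e2.
exists (Num.min d1 d2); first by rewrite lt_min d10.
move=> x x1; rewrite lt_min => /andP[/(H1 _ x1) h1 /(H2 _ x1) h2].
by rewrite (le_trans (ler_normD _ _))//; lra.
Qed.

Lemma sphere_smallM a f1 f2 (C d : R) : 0 < d ->
  (forall x, usphere x -> `|x - a| < d -> `|f1 x| <= C) ->
  sphere_small a f2 -> sphere_small a (fun x => f1 x * f2 x).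
Proof.
move=> d0 f1C s2 e e0; have C1 : 0 < `|C| + 1 by rewrite ltr_wpDl.
have [d2 d20 H2] := s2 _ (divr_gt0 e0 C1).
exists (Num.min d d2); first by rewrite lt_min d0.
move=> x x1; rewrite lt_min => /andP[/(f1C _ x1) h1 /(H2 _ x1) h2].
rewrite normrM (le_trans (ler_pM _ _ (_ : _ <= `|C| + 1) h2))//.
  by rewrite (le_trans h1)// (le_trans (ler_norm _))// lerDl.
by rewrite mulrA mulrCA mulfV ?mulr1// gt_eqF.
Qed.

Lemma sphere_smallZ a (c : R) f : sphere_small a f -> sphere_small a (fun x => c * f x).
Proof.
by move=> sf; apply: (@sphere_smallM _ (fun=> c) f `|c| 1).
Qed.

Lemma sphere_small_quadratic a f (C d : R) : 0 < d ->
  (forall x, usphere x -> `|x - a| < d -> `|f x| <= C * `|x - a| ^+ 2) ->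
  sphere_small a f.
Proof.
move=> d0 fC e e0; have C1 : 0 < `|C| + 1 by rewrite ltr_wpDl.
exists (Num.min d (e / (`|C| + 1))); first by rewrite lt_min d0 divr_gt0.
move=> x x1; rewrite lt_min ltr_pdivlMr// => /andP[/(fC _ x1) h1 h2].
rewrite (le_trans h1)// expr2 mulrA ler_wpM2r// (le_trans _ (ltW h2))// mulrC.
by rewrite ler_wpM2l// (le_trans (ler_norm _))// lerDl.
Qed.

Lemma sphere_dotp_sub a x : usphere a -> usphere x ->
  dotp a (x - a) = - (dotp (x - a) (x - a) / 2).
Proof.
rewrite /usphere/= => a1 x1.
rewrite !dotpBr [dotp (x - a) x]dotpC [dotp (x - a) a]dotpC !dotpBr.
by rewrite a1 x1 (dotpC x a); field.
Qed.

Lemma dotp_sqr_le x : `|dotp x x| <= n%:R * `|x| ^+ 2.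
Proof.
rewrite (le_trans (dotp_le _ _))// expr2 mulrA ler_wpM2r//.
rewrite (le_trans (ler_sum _ (fun i _ => coord_le_norm x i)))//.
by rewrite sumr_const card_ord mulr_natl.
Qed.

(** On the sphere the radial displacement is of second order. A multiple of [a] can therefore be
    added to an ambient gradient to make it tangential. *)
Lemma sphere_small_dotp a : usphere a -> sphere_small a (fun x => dotp a (x - a)).
Proof.
move=> a1; apply: (@sphere_small_quadratic _ _ (n%:R / 2) 1) => // x x1 _.
rewrite sphere_dotp_sub// normrN normrM [`|2^-1|]ger0_norm// mulrAC.
by rewrite ler_wpM2r// dotp_sqr_le.
Qed.

(* Rational parametrization of the great circle through [a] in the direction of
   a tangent vector [u] of arbitrary length. *)
Definition great_circle a (u : 'rV[R]_n) (t : R) : 'rV[R]_n :=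
  (1 + t ^+ 2 * dotp u u)^-1 *: ((1 - t ^+ 2 * dotp u u) *: a + (2 * t) *: u).

Lemma dotp_ge0 x : 0 <= dotp x x.
Proof. by apply: sumr_ge0 => i _; rewrite -expr2 sqr_ge0. Qed.

Lemma great_circle_denom u (t : R) : 0 < 1 + t ^+ 2 * dotp u u.
Proof. by rewrite ltr_wpDr// mulr_ge0 ?sqr_ge0 ?dotp_ge0. Qed.

Lemma usphere_great_circle a u (t : R) : usphere a -> dotp u a = 0 ->
  usphere (great_circle a u t).
Proof.
rewrite /usphere/= => a1 ua; have D0 := great_circle_denom u t.
rewrite dotpZr dotpC dotpZr dotpDr !dotpZr dotpC dotpDr !dotpZr.
rewrite [dotp (_ + _) u]dotpC dotpDr !dotpZr a1 (dotpC a u) ua.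
by field; rewrite gt_eqF.
Qed.

Lemma great_circle_sub a u (t : R) : great_circle a u t - a =
  (1 + t ^+ 2 * dotp u u)^-1 *: ((- 2 * t ^+ 2 * dotp u u) *: a + (2 * t) *: u).
Proof.
have D0 := great_circle_denom u t.
by apply/rowP => i; rewrite !mxE; field; rewrite gt_eqF.
Qed.

Lemma great_circle_dist a u (t : R) : 0 <= t <= 1 ->
  `|great_circle a u t - a| <=
    (1 + t ^+ 2 * dotp u u)^-1 * (2 * t * (dotp u u * `|a| + `|u|)).
Proof.
move=> /andP[t0 t1]; have D0 := great_circle_denom u t.
rewrite great_circle_sub normrZ gtr0_norm ?invr_gt0// ler_pM2l ?invr_gt0//.
rewrite (le_trans (ler_normD _ _))// !normrZ.
rewrite normrN (ger0_norm t0) (ger0_norm (dotp_ge0 u)) (ger0_norm (ler0n _ 2)).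
(* This is [t ^+ 2 <= t], weighted by the coefficient of [a]. *)
have : 0 <= t * (1 - t) * (dotp u u * `|a|).
  by rewrite !mulr_ge0 ?dotp_ge0// subr_ge0.
move: (dotp u u) `|a| `|u| => w A U; nra.
Qed.

(** Along the great circle in direction [u], the product with [u] and the bound on the displacement
    are [2 * t * w] and [2 * t * C] up to a common factor. Smallness thus forces [w] below every
    positive number. *)
Lemma sphere_small_dotp_eq0 a u : usphere a -> dotp u a = 0 ->
  sphere_small a (fun x => dotp u (x - a)) -> u = 0.
Proof.
move=> a1 ua su; apply/eqP; rewrite -dotp_eq0; pose w := dotp u u.
have w0 : 0 <= w := dotp_ge0 u.
pose C := w * `|a| + `|u|.
have C0 : 0 <= C by rewrite addr_ge0// mulr_ge0.
rewrite eq_le dotp_ge0 andbT; apply/ler_addgt0Pl => e e0; rewrite addr0.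
have C1 : 0 < C + 1 by rewrite ltr_wpDl.
have [d d0 H] := su _ (divr_gt0 e0 C1).
(* [t <= 1] is needed by [great_circle_dist], and the other bound keeps the point within [d] of [a].
   Using [C + 1] avoids dividing by a vanishing [C]. *)
pose t := Num.min 1 (d / (2 * (C + 1))).
have t0 : 0 < t by rewrite lt_min ltr01 divr_gt0// mulr_gt0.
have t1 : t <= 1 by rewrite ge_min lexx.
have td : t * (2 * (C + 1)) <= d by rewrite -ler_pdivlMr ?mulr_gt0// ge_min lexx orbT.
have D0 := great_circle_denom u t.
have D1 : (1 + t ^+ 2 * w)^-1 <= 1.
  by rewrite invf_le1// lerDl mulr_ge0// sqr_ge0.
have t01 : 0 <= t <= 1 by rewrite ltW.
have dist := great_circle_dist a u t01.
have := H _ (usphere_great_circle t a1 ua).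
have -> : dotp u (great_circle a u t - a) = (1 + t ^+ 2 * w)^-1 * (2 * t * w).
  by rewrite great_circle_sub dotpZr dotpDr !dotpZr ua mulr0 add0r.
have near_a : `|great_circle a u t - a| < d.
  rewrite (le_lt_trans dist)// (le_lt_trans (ler_wpM2r _ D1))//.
    by rewrite mulr_ge0// mulr_ge0// ltW.
  by rewrite mul1r (lt_le_trans _ td)// mulrCA mulrA ltr_pM2l ?mulr_gt0// ltrDl.
move=> /(_ near_a) /le_trans /(_ (ler_wpM2l _ dist)).
rewrite ger0_norm; last by rewrite !mulr_ge0 ?invr_ge0 ?(ltW D0) ?(ltW t0).
move=> /(_ (ltW (divr_gt0 e0 C1))).
rewrite -/w -/C [leRHS]mulrCA ler_pM2l ?invr_gt0// [leRHS]mulrCA ler_pM2l ?mulr_gt0//.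
move=> /le_trans; apply; rewrite mulrAC ler_pdivrMr// ler_pM2l// lerDl//.
Qed.

Lemma sphere_gradient_unique f a g1 g2 : usphere a ->
  sphere_gradient f a g1 -> sphere_gradient f a g2 -> g1 = g2.
Proof.
move=> a1 /sphere_gradientE[g1a s1] /sphere_gradientE[g2a s2].
apply/eqP; rewrite -subr_eq0; apply/eqP/(sphere_small_dotp_eq0 a1).
  by rewrite dotpBl g1a g2a subrr.
apply: (sphere_small_eq ltr01 _ (sphere_smallD s2 (sphere_smallZ (-1) s1))).
by move=> x _ _; rewrite dotpBl; ring.
Qed.

End sphere_calculus.

(** * The gradient of the section volume *)

Section section_gradient.
Context (R : realType) (m : nat) (s : {perm 'I_m.+2}).
Local Notation j := (s 0).
Local Notation k := (s (lift 0 0)).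
Local Notation V a i := (fine (hvol a (convex_hull ([set 0] `|` (facet i `&` hyperplane a))))).
Implicit Types (a x h u : 'rV[R]_m.+2).

Lemma dotp_perm2 x y : dotp x y = x 0 j * y 0 j + x 0 k * y 0 k +
  \sum_i row_tail2 s x 0 i * row_tail2 s y 0 i.
Proof.
rewrite (dotp_perm _ _ s) big_ord_recl addrA; congr (_ + _).
by apply: eq_bigr => i _; rewrite !mxE.
Qed.

Definition row_of_perm (uj uk : R) (v : 'rV[R]_m) : 'rV[R]_m.+2 :=
  \row_i if unlift 0 ((s^-1)%g i) is Some i1 then
    (if unlift 0 i1 is Some i2 then v 0 i2 else uk) else uj.

Lemma row_of_perm_j uj uk v : row_of_perm uj uk v 0 j = uj.
Proof. by rewrite mxE permK unlift_none. Qed.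

Lemma row_of_perm_k uj uk v : row_of_perm uj uk v 0 k = uk.
Proof. by rewrite mxE permK liftK unlift_none. Qed.

Lemma row_of_perm_tail uj uk v i :
  row_of_perm uj uk v 0 (s (lift 0 (lift 0 i))) = v 0 i.
Proof. by rewrite mxE permK !liftK. Qed.

Lemma forall_perm2 (P : 'I_m.+2 -> Prop) :
  (forall i, P i) <-> [/\ P j, P k & forall i, P (s (lift 0 (lift 0 i)))].
Proof.
split=> [Pi|[Pj Pk PS]]; first by split.
apply/(forall_perm s); split=> // i.
by case: (unliftP 0 i) => [i'|] ->.
Qed.

Lemma usphere_coord_le1 a i : usphere a -> `|a 0 i| <= 1.
Proof.
rewrite /usphere/= /dotp (bigD1 i)//= => a1.
rewrite -(@expr_le1 _ 2)// real_normK ?num_real// expr2 -a1 lerDl.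
by apply: sumr_ge0 => l _; rewrite -expr2 sqr_ge0.
Qed.

Lemma sphere_small_abs_mean a (c : R) (v : 'rV[R]_m)
    (cf : 'rV[R]_m.+2 -> R) (vf : 'rV[R]_m.+2 -> 'rV[R]_m) (C : R) :
  (c != 0) || (v != 0) -> 0 < C ->
  (forall h, `|cf h| + \sum_i `|vf h 0 i| <= C * `|h|) ->
  sphere_small a (fun x => abs_mean (c + cf (x - a)) (v + vf (x - a)) -
    abs_mean c v - abs_mean_diff c v (cf (x - a)) (vf (x - a))).
Proof.
move=> cv C0 le_C e e0.
have [d d0 H] := abs_mean_differentiable cv (divr_gt0 e0 C0).
exists (d / C); first by rewrite divr_gt0.
move=> x _ xd; rewrite (le_trans (H _ _ _))//.
  by rewrite (le_trans (le_C _))// mulrC -ler_pdivlMr// ltW.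
rewrite (le_trans (ler_wpM2l _ (le_C _)))//; first by rewrite divr_ge0// ltW.
by rewrite mulrA divfK// gt_eqF.
Qed.

Let pertC (b : R) : `|b| <= 1 -> forall h,
  `|h 0 j + b * h 0 k| + \sum_i `|row_tail2 s h 0 i| <= m.+2%:R * `|h|.
Proof.
move=> b1 h; have E : m.+2%:R = 1 + 1 + m%:R :> R by rewrite -addn2 natrD addrC.
rewrite E !mulrDl mul1r; apply: lerD.
  rewrite (le_trans (ler_normD _ _))// lerD ?coord_le_norm// normrM.
  by rewrite (le_trans (ler_piMl _ b1))// coord_le_norm.
rewrite mulr_natl -[X in _ *+ X]card_ord -sumr_const ler_sum// => i _.
by rewrite mxE coord_le_norm.
Qed.

(** The vector [u] below is the ambient gradient, by the quotient rule, of the [Phi] difference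
    divided by [x_j x_k]. That quotient equals the section volume only on the sphere. By Euler's
    identity [dotp u a = - S], so [u + S *: a] is the tangential part. *)
Lemma section_gradient_exists a : usphere a -> a 0 j != 0 -> a 0 k != 0 ->
  (a 0 j + a 0 k != 0) || (row_tail2 s a != 0) ->
  (a 0 j - a 0 k != 0) || (row_tail2 s a != 0) ->
  exists2 g, sphere_gradient (@central_section_volume R m.+2) a g &
    a 0 k * g 0 k = 2 * m.+1%:R * V a k -
      central_section_volume a * (1 - a 0 k ^+ 2) /\
    forall i, a 0 i = 0 -> g 0 i = 0.
Proof.
move=> a1 aj ak hp hm.
have aa : dotp a a = 1 := a1.
set S := central_section_volume a; set p := a 0 j * a 0 k.
have p0 : p != 0 by rewrite mulf_neq0.
set v := row_tail2 s a in hp hm.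
pose Np := sgn_mean (a 0 j + a 0 k) v; pose Nm := sgn_mean (a 0 j - a 0 k) v.
pose Mp i := sgn_moment (a 0 j + a 0 k) v i.
pose Mm i := sgn_moment (a 0 j - a 0 k) v i.
pose u := row_of_perm ((Np - Nm - S * a 0 k) / p) ((Np + Nm - S * a 0 j) / p)
  (\row_i ((Mp i - Mm i) / p)).
pose Lp h := abs_mean_diff (a 0 j + a 0 k) v (h 0 j + 1 * h 0 k) (row_tail2 s h).
pose Lm h := abs_mean_diff (a 0 j - a 0 k) v (h 0 j + -1 * h 0 k) (row_tail2 s h).
have uE h : dotp u h = (Lp h - Lm h - S * (a 0 j * h 0 k + a 0 k * h 0 j)) / p.
  rewrite dotp_perm2 row_of_perm_j row_of_perm_k.
  rewrite /Lp /Lm /abs_mean_diff -/Np -/Nm.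
  have -> : \sum_i row_tail2 s u 0 i * row_tail2 s h 0 i =
      (\sum_i Mp i * row_tail2 s h 0 i - \sum_i Mm i * row_tail2 s h 0 i) / p.
    rewrite -sumrB mulr_suml; apply: eq_bigr => i _.
    by rewrite [row_tail2 s u 0 i]mxE row_of_perm_tail mxE; field.
  by field; exact: p0.
have Sa : p * S = abs_mean (a 0 j + a 0 k) v - abs_mean (a 0 j - a 0 k) v.
  exact: central_section_volumeE.
have ua : dotp u a = - S.
  rewrite uE /Lp /Lm mul1r mulN1r !abs_mean_diff_id -Sa /p.
  by field; rewrite aj ak.
exists (u + S *: a); last first.
  split; last first.
    apply/forall_perm2; split=> [/eqP|/eqP|i ai0]; rewrite ?(negbTE aj) ?(negbTE ak)//.
    have ui : u 0 (s (lift 0 (lift 0 i))) = (Mp i - Mm i) / p.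
      by rewrite row_of_perm_tail mxE.
    by rewrite mxE ui mxE ai0 /Mp /Mm !sgn_moment_eq0 ?mxE ?ai0// subrr mul0r mulr0 addr0.
  rewrite mxE row_of_perm_k mxE.
  have V2 : 2 * m.+1%:R * V a k = (Np + Nm) / a 0 j.
    by rewrite -(cone_volume_sgn_mean a1 aj hp hm); field.
  by rewrite V2 /p; field; rewrite aj ak.
apply/sphere_gradientE; split.
  by rewrite dotpC dotpDr dotpZr dotpC ua aa mulr1 addNr.
have n1 : `|1 : R| <= 1 by rewrite normr1.
have nN1 : `|-1 : R| <= 1 by rewrite normrN1.
have sp := @sphere_small_abs_mean a _ _ (fun h => h 0 j + 1 * h 0 k)
  (row_tail2 s) m.+2%:R hp (ltr0Sn _ _) (pertC n1).
have sm := @sphere_small_abs_mean a _ _ (fun h => h 0 j + -1 * h 0 k)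
  (row_tail2 s) m.+2%:R hm (ltr0Sn _ _) (pertC nN1).
(* [q (x - a)] is the exact increment of the denominator [x_j x_k]. *)
pose q h := a 0 j * h 0 k + a 0 k * h 0 j + h 0 j * h 0 k.
have qE x : p + q (x - a) = x 0 j * x 0 k by rewrite /p /q !mxE; ring.
have q_le h : `|h| < 1 -> `|q h| <= 3 * `|h|.
  move=> h1.
  have hj := coord_le_norm h j; have hk := coord_le_norm h k.
  have aj1 := usphere_coord_le1 j a1; have ak1 := usphere_coord_le1 k a1.
  have -> : 3 * `|h| = `|h| + `|h| + `|h| by ring.
  rewrite (le_trans (ler_normD _ _))// lerD//.
    by rewrite (le_trans (ler_normD _ _))// lerD// normrM (le_trans (ler_piMl _ _)).
  by rewrite normrM (le_trans (ler_piMl _ _))// (le_trans hj)// ltW.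
(* Since [|q h| <= 3 * |h|], the denominator keeps at least half of its modulus within this
   distance. *)
pose d := Num.min 1 (`|p| / 6).
have d0 : 0 < d by rewrite lt_min ltr01 divr_gt0 ?normr_gt0.
have prod_ge x : `|x - a| < d -> `|p| / 2 <= `|x 0 j * x 0 k|.
  rewrite lt_min => /andP[/q_le h1 h6]; rewrite -qE.
  have := lerB_normD p (q (x - a)); lra.
(* The remainder multiplied by [x_j x_k] splits into four parts: the remainders of the two [Phi]
   terms, the quadratic term of the denominator, and the linear term times the increment of the
   denominator. *)
pose small1 x := abs_mean (a 0 j + a 0 k + ((x - a) 0 j + 1 * (x - a) 0 k))
  (v + row_tail2 s (x - a)) - abs_mean (a 0 j + a 0 k) v - Lp (x - a).
pose small2 x := abs_mean (a 0 j - a 0 k + ((x - a) 0 j + -1 * (x - a) 0 k))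
  (v + row_tail2 s (x - a)) - abs_mean (a 0 j - a 0 k) v - Lm (x - a).
pose small3 x := (x - a) 0 j * (x - a) 0 k.
pose small4 x := dotp u (x - a) * q (x - a).
have s3 : sphere_small a small3.
  apply: (@sphere_small_quadratic _ _ _ _ 1 1) => // x _ _.
  by rewrite mul1r normrM expr2 ler_pM// coord_le_norm.
have s4 : sphere_small a small4.
  apply: (@sphere_small_quadratic _ _ _ _ (3 * \sum_i `|u 0 i|) 1) => // x _ h1.
  rewrite normrM (le_trans (ler_pM _ _ (dotp_le _ _) (q_le _ h1)))//.
  by rewrite le_eqVlt; apply/orP; left; apply/eqP; ring.
have s1234 : sphere_small a (fun x => (x 0 j * x 0 k)^-1 *
    (small1 x + -1 * small2 x + - S * small3 x + -1 * small4 x)).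
  apply: (@sphere_smallM _ _ _ _ _ (2 / `|p|) d) => //.
    move=> x _ /prod_ge h; rewrite normfV -[2 / _]invrK invf_div.
    have p2 : 0 < `|p| / 2 by rewrite divr_gt0 ?normr_gt0.
    by rewrite lef_pV2 ?posrE// (lt_le_trans p2 h).
  apply: sphere_smallD; last exact: sphere_smallZ.
  apply: sphere_smallD; last exact: sphere_smallZ.
  by apply: sphere_smallD => //; exact: sphere_smallZ.
have s5 := sphere_smallZ (- S) (sphere_small_dotp a1).
apply: (sphere_small_eq d0 _ (sphere_smallD s1234 s5)) => x x1 xd.
have xjk : x 0 j * x 0 k != 0.
  by rewrite -normr_gt0 (lt_le_trans _ (prod_ge _ xd))// divr_gt0 ?normr_gt0.
have [xj xk] : x 0 j != 0 /\ x 0 k != 0.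
  by apply/andP; move: xjk; rewrite mulf_eq0 negb_or.
have Sx := central_section_volumeE x1 xj xk.
have tE : v + row_tail2 s (x - a) = row_tail2 s x.
  by apply/rowP => i; rewrite !mxE; ring.
have cpE : a 0 j + a 0 k + ((x - a) 0 j + 1 * (x - a) 0 k) = x 0 j + x 0 k.
  by rewrite !mxE; ring.
have cmE : a 0 j - a 0 k + ((x - a) 0 j + -1 * (x - a) 0 k) = x 0 j - x 0 k.
  by rewrite !mxE; ring.
set h := x - a; set D := dotp u h.
have LE : Lp h - Lm h = p * D + S * (a 0 j * h 0 k + a 0 k * h 0 j).
  by rewrite /D uE; field.
have key : small1 x + -1 * small2 x + - S * small3 x + -1 * small4 x =
    x 0 j * x 0 k * (central_section_volume x - S - D).
  rewrite /small1 /small2 tE cpE cmE -/h.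
  transitivity (x 0 j * x 0 k * central_section_volume x - p * S - (Lp h - Lm h) -
      S * small3 x - small4 x); first by rewrite Sx Sa; ring.
  by rewrite LE -qE /small3 /small4 -/h -/D /q; ring.
rewrite key mulKf// [dotp (u + _) _]dotpC dotpDr dotpZr ![dotp h _]dotpC -/D -/S.
by ring.
Qed.

End section_gradient.

(** * Positivity, degenerate cones, and criticality in terms of cone volumes *)

Section special_directions.
Context (R : realType).
Local Notation T := (measurableTypeR R).
Local Notation lam := (lebesgueRn R).
Local Notation V a i := (fine (hvol a (convex_hull ([set 0] `|` (facet i `&` hyperplane a))))).

Lemma slab_full N (b : 'rV[R]_N) (h : R) : \sum_i `|b 0 i| <= h ->
  slab 0 b h = @qcube R N.
Proof.
move=> bh; apply/seteqP; split=> [z []//|z Qz]; split=> //=.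
rewrite -ler_norml (le_trans (affine_form_bound _ _ Qz))//.
by rewrite normr0 add0r.
Qed.

(** When one coordinate dominates the sum of the others, the section projects onto the whole cube of
    one dimension less. This covers neighbourhoods of the axes as well as the diagonals of
    2-faces. *)
Lemma section_volume_full N (x : 'rV[R]_N.+1) (s : {perm 'I_N.+1}) :
  usphere x -> x 0 (s 0) != 0 -> \sum_i `|x 0 (s (lift 0 i))| <= `|x 0 (s 0)| ->
  central_section_volume x = `|x 0 (s 0)|^-1 * 2 ^+ N.
Proof.
move=> x1 xs0 xs; rewrite /central_section_volume (@hvol_section _ _ _ s)//.
rewrite slab_full ?lebesgueRn_qcube//.
by rewrite (le_trans _ xs)// ler_sum// => i _; rewrite mxE.
Qed.

Lemma section_volume_gt0 N (x : 'rV[R]_N.+1) : usphere x ->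
  0 < central_section_volume x.
Proof.
move=> x1; have [i xi] : exists i, x 0 i != 0.
  apply/existsP; rewrite -[X in is_true X]negbK; apply/negP => /existsPn x0.
  have : dotp x x = 1 := x1.
  rewrite /dotp big1 => [/eqP|i _]; first by rewrite eq_sym oner_eq0.
  by move/negPn/eqP : (x0 i) => ->; rewrite mul0r.
pose s := tperm 0 i; have s0 : s 0 = i by rewrite tpermL.
rewrite -s0 in xi.
rewrite /central_section_volume (@hvol_section _ _ _ s)//.
rewrite fineM//; last exact: slab_fin_num.
set b := \row_i0 _; set h := `|x 0 (s 0)|.
have h0 : 0 < h by rewrite normr_gt0.
rewrite mulr_gt0//= ?invr_gt0//.
pose B := \sum_i `|b 0 i|; have B0 : 0 <= B by apply: sumr_ge0.
have hB : 0 < h + B by rewrite ltr_pwDl.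
(* The cube of half-side [r] lies in the slab, because [r <= 1] and [r * B <= h]. *)
pose r := h / (h + B); have r0 : 0 < r by rewrite divr_gt0.
have r1 : r <= 1 by rewrite ler_pdivrMr// mul1r lerDl.
have rB : r * B <= h.
  by rewrite /r mulrAC ler_pdivrMr// ler_pM2l// lerDr ltW.
have tE (z : N.-tuple T) i0 : tnth (affine (r^-1)%:M 0 z) i0 = tnth z i0 / r.
  by rewrite tnth_mktuple addr0 mul_mx_scalar !mxE mulrC.
have sub : affine (r^-1)%:M 0 @^-1` @qcube R N `<=` slab 0 b h.
  move=> z /= Qz.
  have zr i0 : `|tnth z i0| <= r.
    have := Qz i0; rewrite tE -ler_norml normrM normfV (gtr0_norm r0).
    by rewrite ler_pdivrMr// mul1r.
  split=> [i0|/=]; first by rewrite -ler_norml (le_trans (zr i0)).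
  rewrite -ler_norml /affine_form add0r (le_trans (ler_norm_sum _ _ _))//.
  rewrite (le_trans _ rB)// /B mulr_sumr ler_sum// => i0 _.
  by rewrite normrM ler_wpM2r.
have := @lebesgueRn_affine R N (r^-1)%:M 0 (@qcube R N).
have u1 : ((r^-1)%:M : 'M[R]_N) \in unitmx.
  by rewrite unitmxE det_scalar unitfE expf_neq0// invr_eq0 gt_eqF.
move=> /(_ u1 (@measurable_qcube R N)); rewrite lebesgueRn_qcube => E.
rewrite -lte_fin fineK; last exact: slab_fin_num.
apply: (@lt_le_trans _ _ (lam N (affine (r^-1)%:M 0 @^-1` @qcube R N))).
  rewrite E -EFinM lte_fin mulr_gt0 ?exprn_gt0// invr_gt0 normr_gt0.
  by rewrite -unitfE -unitmxE.
apply: le_measure sub; rewrite inE; last exact: measurable_slab.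
exact: measurable_affine_preimage (@measurable_qcube R N).
Qed.

(** The facet misses the hyperplane, so the cone is the single point [0]. This agrees with
    [1 - a_k ^+ 2 = 0] there. *)
Lemma hvol_cone_axis N (a : 'rV[R]_N.+2) (s : {perm 'I_N.+2}) :
  usphere a -> a 0 (s 0) != 0 -> (forall i, a 0 (s (lift 0 i)) = 0) ->
  hvol a (convex_hull ([set 0] `|` (facet (s 0) `&` hyperplane a))) = 0%E.
Proof.
move=> a1 as0 a0; rewrite convex_hull_facet.
set A := [set x | _].
have headE t : hyperplane_point a s t 0 (s 0) = 0.
  rewrite hyperplane_point_head big1 ?oppr0 ?mul0r// => i _.
  by rewrite a0 mulr0.
have AE : [set t | A (hyperplane_point a s t)] = [set t | forall i, 0 <= tnth t i <= 0].
  apply/seteqP; split => t; rewrite /A/= headE.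
    move=> [_ [_ /(forall_perm s)[_ ht]]] i.
    by have := ht i; rewrite hyperplane_point_tail normr_le0 => /eqP ->; rewrite lexx.
  move=> t0; split; first exact: dotp_hyperplane_point.
  split=> //; apply/(forall_perm s); split=> [|i]; first by rewrite headE normr0.
  by rewrite hyperplane_point_tail normr_le0; have := t0 i; rewrite -eq_le eq_sym.
have mA : measurable [set t : N.+1.-tuple T | forall i, 0 <= tnth t i <= 0].
  apply: measurable_bigcap_ord => i; apply: measurable_itv_preimage.
  exact: measurable_tnth.
rewrite (@hvolE _ _ a s)// AE//.
suff -> : lam N.+1 [set t | forall i, (0 <= tnth t i <= 0)%R] = 0%E by rewrite mule0.
pose b : 'rV[R]_N.+1 := delta_mx 0 0.
apply: (@subset_measure0 _ _ _ (lam N.+1) _ [set t | affine_form 0 b t = 0]) => //.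
- rewrite (_ : [set t | _] = [set t | 0 <= affine_form 0 b t <= 0]).
    exact: measurable_affine_form_itv.
  by apply/seteqP; split => t /=; rewrite -eq_le eq_sym => /eqP.
- move=> t /= t0; rewrite /affine_form add0r big1// => i _.
  by have := t0 i; rewrite -eq_le => /eqP <-; rewrite mul0r.
apply: lebesgueRn_affine_form_eq0; apply/orP; right.
by apply/eqP => /rowP/(_ 0); rewrite !mxE !eqxx => /eqP; rewrite oner_eq0.
Qed.

Lemma perm_pair m (j k : 'I_m.+2) : j != k ->
  exists s : {perm 'I_m.+2}, s 0 = j /\ s (lift 0 0) = k.
Proof.
move=> jk; exists (tperm (lift 0 0) (tperm 0 j k) * tperm 0 j)%g.
rewrite !permM; split; last by rewrite tpermL tpermK.
have nk : tperm 0 j k != 0.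
  apply/eqP => /(congr1 (tperm 0 j)); rewrite tpermK tpermL => kj.
  by rewrite kj eqxx in jk.
by rewrite (tpermD _ nk)// tpermL.
Qed.

(* Holds for some [g] at every [a] that is not a diagonal of a 2-face: the
   gradient measures the deviation of the cone volumes from [mu (1 - a_i^2)]. *)
Definition cone_gradient m (a g : 'rV[R]_m.+2) :=
  sphere_gradient (@central_section_volume R m.+2) a g /\
  forall i, a 0 i * g 0 i = 2 * m.+1%:R * V a i -
    central_section_volume a * (1 - a 0 i ^+ 2) /\ (a 0 i = 0 -> g 0 i = 0).

Lemma diagonal_2face_intro m (a : 'rV[R]_m.+2) (s : {perm 'I_m.+2}) :
  usphere a -> `|a 0 (s 0)| = `|a 0 (s (lift 0 0))| -> row_tail2 s a = 0 ->
  diagonal_2face a.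
Proof.
move=> a1 ajk at0; have aa : dotp a a = 1 := a1.
have sq : `|a 0 (s 0)| = (Num.sqrt 2)^-1.
  apply: (@pexpIrn _ 2) => //; rewrite ?nnegrE ?invr_ge0 ?sqrtr_ge0//.
  rewrite exprVn sqr_sqrtr//; move: aa; rewrite (dotp_perm2 s) at0 big1; last first.
    by move=> i _; rewrite mxE mul0r.
  rewrite addr0 -!expr2 -(real_normK (num_real (a 0 (s (lift 0 0))))) -ajk.
  by rewrite -(real_normK (num_real (a 0 (s 0)))); lra.
exists s, (fun i => a 0 (s i) < 0) => i.
case: (unliftP 0 i) => [i'|] ->; last first.
  by rewrite /= -sq -realEsign ?num_real.
case: (unliftP 0 i') => [i''|] ->; last first.
  by rewrite /= -sq ajk -realEsign ?num_real.
rewrite /= mulr0; have /rowP/(_ i'') := at0.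
by rewrite !mxE.
Qed.

(** The gradient comes from one pair, and its [i]-th coordinate is read off from a pair containing
    [i]. Both gradients agree by uniqueness. Zero coordinates use [cone_volume_coord0]. *)
Lemma cone_gradient_exists m (a : 'rV[R]_m.+2) : usphere a -> ~ diagonal_2face a ->
  (exists i j, [/\ i != j, a 0 i != 0 & a 0 j != 0]) -> exists g, cone_gradient a g.
Proof.
move=> a1 nd [i0 [j0 [ij0 ai0 aj0]]].
have pair j k : j != k -> a 0 j != 0 -> a 0 k != 0 ->
  exists2 g, sphere_gradient (@central_section_volume R m.+2) a g &
    a 0 k * g 0 k = 2 * m.+1%:R * V a k -
      central_section_volume a * (1 - a 0 k ^+ 2) /\
    forall i, a 0 i = 0 -> g 0 i = 0.
  move=> jk; have [s [sj sk]] := perm_pair jk; rewrite -sj -sk => aj ak.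
  apply: section_gradient_exists => //.
    have [tl0|//] := eqVneq (row_tail2 s a) 0; last by rewrite orbT.
    rewrite orbF; apply: contra_notN nd; rewrite addr_eq0 => /eqP E.
    by apply: (diagonal_2face_intro a1 _ tl0); rewrite E normrN.
  have [tl0|//] := eqVneq (row_tail2 s a) 0; last by rewrite orbT.
  rewrite orbF; apply: contra_notN nd; rewrite subr_eq0 => /eqP E.
  by apply: (diagonal_2face_intro a1 _ tl0); rewrite E.
have [g gP [_ g0]] := pair _ _ ij0 ai0 aj0.
exists g; split=> // i; split; last exact: g0.
have [ai|ai] := eqVneq (a 0 i) 0.
  have ii0 : i0 != i by apply: contraNneq ai0 => ->; rewrite ai.
  have [s [si0 si]] := perm_pair ii0.
  rewrite -si (@cone_volume_coord0 _ _ s)// ?si0 ?si// ai.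
  by rewrite mul0r expr0n/= subr0 mulr1 subrr.
have [j ij aj] : exists2 j, j != i & a 0 j != 0.
  have [<-|] := eqVneq i0 i; last by move=> ?; exists i0.
  by exists j0 => //; rewrite eq_sym.
by have [g' g'P [<- _]] := pair _ _ ij aj ai; rewrite (sphere_gradient_unique a1 gP g'P).
Qed.

Lemma hvol_coneE m (a : 'rV[R]_m.+2) i : usphere a ->
  hvol a (convex_hull ([set 0] `|` (facet i `&` hyperplane a))) = (V a i)%:E.
Proof.
move=> a1; have [[j ji aj]|a0] := pselect (exists2 j, j != i & a 0 j != 0).
  have [s [sj si]] := perm_pair ji.
  by rewrite -si (@hvol_cone_fin _ _ s)// sj.
pose s := tperm 0 i; have s0 : s 0 = i by rewrite tpermL.
have at0 l : a 0 (s (lift 0 l)) = 0.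
  apply/eqP; apply: contra_notT a0 => al; exists (s (lift 0 l)) => //.
  by rewrite -s0 (inj_eq perm_inj).
have as0 : a 0 (s 0) != 0.
  apply: contraPneq (oner_neq0 R) => as0; have aa : dotp a a = 1 := a1.
  rewrite -aa (dotp_perm _ _ s) as0 mul0r add0r big1 ?eqxx// => l _.
  by rewrite at0 mul0r.
by rewrite -s0 hvol_cone_axis.
Qed.

Lemma critical_of_cone_gradient m (a g : 'rV[R]_m.+2) : usphere a ->
  cone_gradient a g ->
  (critical_direction a <-> exists2 mu : R, 0 < mu & forall i,
    hvol a (convex_hull ([set 0] `|` (facet i `&` hyperplane a))) =
      (mu * (1 - a 0 i ^+ 2))%:E).
Proof.
move=> a1 [gP gE]; set S := central_section_volume a in gE.
have S0 : 0 < S by exact: section_volume_gt0.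
have M0 : 0 < m.+1%:R :> R by rewrite ltr0n.
have M2 : 2 * m.+1%:R != 0 :> R by rewrite mulf_neq0 ?gt_eqF.
split=> [[_ [[]|g0]]|[mu mu0 muE]]; first by exists g.
  have {}g0 := sphere_gradient_unique a1 gP g0.
  exists (S / (2 * m.+1%:R)) => [|i]; first by rewrite divr_gt0// mulr_gt0.
  rewrite hvol_coneE//; congr EFin; apply: (mulfI M2).
  have [+ _] := gE i; rewrite g0 mxE mulr0 => /esym/eqP; rewrite subr_eq0 => /eqP ->.
  by rewrite mulrA [X in _ = X * _]mulrC divfK.
have VE i : V a i = mu * (1 - a 0 i ^+ 2).
  by have := muE i; rewrite hvol_coneE// => -[].
suff muS : 2 * m.+1%:R * mu = S.
  split=> //; right; suff <- : g = 0 by [].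
  apply/rowP => i; rewrite mxE; have [gi g0] := gE i.
  have [/g0//|ai] := eqVneq (a 0 i) 0.
  by apply: (mulfI ai); rewrite gi VE mulrA muS subrr mulr0.
have [ga _] := gP.
(* The left-hand side is 0 by tangency. The last factor is the sum of [1 - a_i ^+ 2], that is
   [m.+2 - 1], which is nonzero. *)
have : \sum_i (a 0 i * g 0 i) = (2 * m.+1%:R * mu - S) * m.+1%:R.
  rewrite (eq_bigr (fun i => (2 * m.+1%:R * mu - S) * (1 - a 0 i ^+ 2))); last first.
    by move=> i _; have [-> _] := gE i; rewrite VE; ring.
  rewrite -mulr_sumr sumrB sumr_const card_ord.
  have -> : \sum_i a 0 i ^+ 2 = 1 by rewrite -[RHS]a1; apply: eq_bigr => i _; rewrite expr2.
  by congr (_ * _); rewrite -(natrB _ (ltn0Sn _)) subn1.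
rewrite -[LHS]/(dotp a g) dotpC ga => /esym/eqP.
by rewrite mulf_eq0 (gt_eqF M0) orbF subr_eq0 => /eqP.
Qed.

End special_directions.

(** * Axes and diagonals *)

Section exceptional_directions.
Context (R : realType).
Local Notation T := (measurableTypeR R).
Local Notation lam := (lebesgueRn R).
Local Notation V a i := (fine (hvol a (convex_hull ([set 0] `|` (facet i `&` hyperplane a))))).

(** Near an axis the section volume is exactly [2 ^+ m.+1 / |x_j|]. On the sphere [|x_j|] differs
    from 1 only to second order. *)
Lemma cone_gradient_axis m (a : 'rV[R]_m.+2) (s : {perm 'I_m.+2}) : usphere a ->
  (forall i, a 0 (s (lift 0 i)) = 0) -> cone_gradient a 0.
Proof.
move=> a1 a0; have aa : dotp a a = 1 := a1.
have aj2 : a 0 (s 0) ^+ 2 = 1.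
  rewrite -[RHS]aa (dotp_perm _ _ s) big1 ?addr0 ?expr2// => i _.
  by rewrite a0 mul0r.
have aj : a 0 (s 0) != 0 by rewrite -sqrf_eq0 aj2 oner_neq0.
have naj : `|a 0 (s 0)| = 1.
  by apply/eqP; rewrite -(@sqrp_eq1 _ `|_|)// real_normK ?num_real// aj2.
have csv_a : central_section_volume a = 2 ^+ m.+1.
  rewrite (@section_volume_full _ _ _ s)// naj ?invr1 ?mul1r//.
  by rewrite big1 ?ler01// => i _; rewrite a0 normr0.
split; last first.
  apply/(forall_perm s); split=> [|i]; split; rewrite ?mxE// mulr0.
    by rewrite hvol_cone_axis// aj2 subrr !mulr0 subrr.
  have si : s 0 != s (lift 0 i) by rewrite (inj_eq perm_inj) neq_lift.
  have [s' [s'0 s'1]] := perm_pair si.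
  rewrite -s'1 (@cone_volume_coord0 _ _ s') ?s'0 ?s'1// a0.
  by rewrite expr0n/= subr0 mulr1 subrr.
apply/sphere_gradientE; split.
  by rewrite /dotp big1// => i _; rewrite mxE mul0r.
have M0 : 0 < m.+2%:R :> R by rewrite ltr0n.
(* Within this distance the other coordinates sum to at most [1 / 2] in modulus, while [|x_j|] stays
   at least [1 / 2]. *)
pose d : R := (2 * m.+2%:R)^-1.
have d0 : 0 < d by rewrite invr_gt0 mulr_gt0.
have dM : d * m.+2%:R = 2^-1 by rewrite /d invfM divfK// gt_eqF.
apply: (@sphere_small_quadratic _ _ _ _ (2 ^+ m.+1 * m.+2%:R) d d0) => x x1 xd.
set h := x - a in xd *; set N := `|h| in xd *.
have hM : N * m.+2%:R <= 2^-1 by rewrite -dM ler_pM2r// ltW.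
have N0 : 0 <= N by exact: normr_ge0.
have hN : N <= 2^-1.
  by rewrite (le_trans _ hM)// ler_peMr// ler1n.
have hjE : h 0 (s 0) = x 0 (s 0) - a 0 (s 0) by rewrite !mxE.
have xj2 : 2^-1 <= `|x 0 (s 0)|.
  have := lerB_normD (a 0 (s 0)) (h 0 (s 0)); rewrite hjE addrCA subrr addr0 naj.
  have := coord_le_norm h (s 0); rewrite hjE -/N; lra.
have xj0 : 0 < `|x 0 (s 0)| by rewrite (lt_le_trans _ xj2)// invr_gt0.
have xj1 : `|x 0 (s 0)| <= 1 by exact: usphere_coord_le1.
have xtail : \sum_i `|x 0 (s (lift 0 i))| <= `|x 0 (s 0)|.
  rewrite (le_trans _ xj2)// (le_trans _ hM)//.
  apply: (@le_trans _ _ (\sum_(i < m.+1) N)).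
    apply: ler_sum => i _; have := coord_le_norm h (s (lift 0 i)).
    by rewrite !mxE a0 subr0.
  rewrite sumr_const card_ord -[_ *+ _]mulr_natr.
  by rewrite ler_wpM2l// ler_nat.
rewrite (@section_volume_full _ _ _ s)// -?normr_gt0// csv_a.
have -> : dotp 0 h = 0 by rewrite /dotp big1// => i _; rewrite mxE mul0r.
have ax : dotp a x = a 0 (s 0) * x 0 (s 0).
  by rewrite (dotp_perm _ _ s) [X in _ + X]big1 ?addr0// => i _; rewrite a0 mul0r.
have ah := sphere_dotp_sub a1 x1; rewrite dotpBr aa -/h in ah.
have hh := dotp_sqr_le h; rewrite ger0_norm ?dotp_ge0// -/N in hh.
have xj_ge : 1 - m.+2%:R * N ^+ 2 / 2 <= `|x 0 (s 0)|.
  have : `|dotp a x| = `|x 0 (s 0)| by rewrite ax normrM naj mul1r.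
  by have := ler_norm (dotp a x); lra.
set y := `|x 0 (s 0)| in xj2 xj0 xj1 xj_ge *.
have -> : y^-1 * 2 ^+ m.+1 - 2 ^+ m.+1 - 0 = 2 ^+ m.+1 * ((1 - y) / y).
  by field; rewrite gt_eqF.
rewrite normrM ger0_norm ?exprn_ge0// -mulrA ler_wpM2l ?exprn_ge0//.
rewrite ger0_norm ?divr_ge0 ?subr_ge0 ?(ltW xj0)// ler_pdivrMr//.
have : 0 <= m.+2%:R * N ^+ 2 by rewrite mulr_ge0 ?sqr_ge0// ltW.
move: (m.+2%:R * N ^+ 2) xj_ge => K; nra.
Qed.

Lemma section_volume_le N (x : 'rV[R]_N.+1) i : usphere x -> x 0 i != 0 ->
  central_section_volume x <= `|x 0 i|^-1 * 2 ^+ N.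
Proof.
move=> x1; pose s := tperm 0 i; have s0 : s 0 = i by rewrite tpermL.
rewrite -s0 => xi; rewrite /central_section_volume (@hvol_section _ _ _ s)//.
rewrite fineM//; last exact: slab_fin_num.
rewrite ler_wpM2l//=.
rewrite -lee_fin fineK; last exact: slab_fin_num.
rewrite -(lebesgueRn_qcube R N); apply: le_measure; rewrite ?inE.
- exact: measurable_slab.
- exact: measurable_qcube.
- by move=> z [].
Qed.

(* Along the great circle through the diagonal in its plane, one of the two
   nonzero coordinates grows at unit speed in either direction, and bounding
   the section by the whole projected cube is exact at the diagonal. *)
Lemma section_volume_corner m (a u : 'rV[R]_m.+2) (s : {perm 'I_m.+2}) (r e t : R) :
  usphere a -> dotp u a = 0 -> dotp u u = 1 -> 0 < r ->
  `|a 0 (s 0)| = r -> `|a 0 (s (lift 0 0))| = r -> `|e| = 1 ->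
  u 0 (s 0) = - e * a 0 (s (lift 0 0)) -> u 0 (s (lift 0 0)) = e * a 0 (s 0) ->
  0 < t <= 2^-1 ->
  central_section_volume (great_circle a u t) <= 2 ^+ m.+1 / r * (1 - t / 2).
Proof.
move=> a1 ua uu r0 aj ak e1 uj uk /andP[t0 t2].
set x := great_circle a u t.
have x1 : usphere x by exact: usphere_great_circle.
have t21 : t ^+ 2 <= 2^-1 * t by rewrite expr2 ler_pM2r.
have t20 : 0 < t ^+ 2 by rewrite exprn_gt0.
have D0 : 0 < 1 + t ^+ 2 by rewrite addr_gt0.
have q0 : 0 < 1 - t ^+ 2 + 2 * t by lra.
have xE i : x 0 i = ((1 - t ^+ 2) * a 0 i + 2 * t * u 0 i) / (1 + t ^+ 2).
  by rewrite !mxE uu mulr1 mulrC.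
(* On one of the two coordinates [u] coincides with [a]. Which one depends on whether [e * a_j] is
   [a_k] or [- a_k]. *)
have [i xi] : exists i, `|x 0 i| = r * (1 - t ^+ 2 + 2 * t) / (1 + t ^+ 2).
  have norm_xi i : `|a 0 i| = r -> u 0 i = a 0 i ->
      `|x 0 i| = r * (1 - t ^+ 2 + 2 * t) / (1 + t ^+ 2).
    move=> air ui; rewrite xE ui -mulrDl normrM normrM normfV air.
    by rewrite (gtr0_norm q0) (gtr0_norm D0) [r * _]mulrC.
  have : `|e * a 0 (s 0)| = `|a 0 (s (lift 0 0))| by rewrite normrM e1 aj ak mul1r.
  move=> /eqP; rewrite eqr_norm2 => /orP[] /eqP E.
    by exists (s (lift 0 0)); apply: norm_xi => //; rewrite uk.
  exists (s 0); apply: norm_xi => //.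
  have e2 : e * e = 1 by rewrite -expr2 -real_normK ?num_real// e1 expr1n.
  by rewrite uj -[RHS]mul1r -e2 -mulrA E mulrN mulNr.
have xi0 : 0 < `|x 0 i| by rewrite xi divr_gt0// mulr_gt0.
have xi_neq0 : x 0 i != 0 by rewrite -normr_gt0.
rewrite (le_trans (section_volume_le x1 xi_neq0))//.
have -> : `|x 0 i|^-1 * 2 ^+ m.+1 =
    2 ^+ m.+1 / r * ((1 + t ^+ 2) / (1 - t ^+ 2 + 2 * t)).
  by rewrite xi; field; rewrite !gt_eqF.
rewrite ler_wpM2l ?divr_ge0 ?exprn_ge0 ?(ltW r0)// ler_pdivrMr//.
(* The difference of the two sides is [3/2 * t * (1 - 2 * t) + t ^+ 3 / 2], which explains the bound
   [t <= 2^-1]. *)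
have : 0 < t ^+ 3 by rewrite exprn_gt0.
rewrite (_ : t ^+ 3 = t ^+ 2 * t); last by ring.
nra.
Qed.

(** At two opposite points of the great circle the section has dropped by at least [c * t / 2],
    where [c] is its value at [a]. The linear terms at these points cancel, so a gradient would
    leave the drop to remainders that are too small. *)
Lemma diagonal_no_gradient m (a : 'rV[R]_m.+2) : usphere a -> diagonal_2face a ->
  ~ exists g, sphere_gradient (@central_section_volume R m.+2) a g.
Proof.
move=> a1 [s [e0 ae]] [g /sphere_gradientE[ga sg]].
pose r : R := (Num.sqrt 2)^-1.
have r0 : 0 < r by rewrite invr_gt0 sqrtr_gt0.
have aj : `|a 0 (s 0)| = r by rewrite ae/= normrMsign ger0_norm// ltW.
have ak : `|a 0 (s (lift 0 0))| = r by rewrite ae/= normrMsign ger0_norm// ltW.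
have at0 i : a 0 (s (lift 0 (lift 0 i))) = 0 by rewrite ae/= mulr0.
have sqrn (z : R) : `|z| = r -> z ^+ 2 = r ^+ 2 by move=> <-; rewrite real_normK ?num_real.
have r2 : r ^+ 2 = 2^-1 by rewrite exprVn sqr_sqrtr.
pose u e := row_of_perm s (- e * a 0 (s (lift 0 0))) (e * a 0 (s 0)) 0.
have ua e : dotp (u e) a = 0.
  rewrite (dotp_perm2 s) row_of_perm_j row_of_perm_k big1; last first.
    by move=> i _; rewrite [row_tail2 s a 0 i]mxE at0 mulr0.
  by ring.
have uu e : `|e| = 1 -> dotp (u e) (u e) = 1.
  move=> e1; have e2 : e ^+ 2 = 1 by rewrite -real_normK ?num_real// e1 expr1n.
  rewrite (dotp_perm2 s) row_of_perm_j row_of_perm_k big1; last first.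
    by move=> i _; rewrite [row_tail2 _ _ 0 i]mxE row_of_perm_tail mxE mul0r.
  transitivity (e ^+ 2 * (a 0 (s 0) ^+ 2 + a 0 (s (lift 0 0)) ^+ 2)); first by ring.
  by rewrite e2 (sqrn _ aj) (sqrn _ ak) r2; field.
have uN : u (-1) = - u 1.
  apply/rowP; apply/(forall_perm2 s); split=> [||i].
  - by rewrite [RHS]mxE !row_of_perm_j; ring.
  - by rewrite [RHS]mxE !row_of_perm_k; ring.
  - by rewrite [RHS]mxE !row_of_perm_tail !mxE oppr0.
have csv_a : central_section_volume a = 2 ^+ m.+1 / r.
  rewrite (@section_volume_full _ _ _ s) ?aj 1?mulrC// -?normr_gt0 ?aj//.
  rewrite big_ord_recl ak big1 ?addr0// => i _; by rewrite at0 normr0.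
set c := 2 ^+ m.+1 / r in csv_a.
have c0 : 0 < c by rewrite divr_gt0// exprn_gt0.
pose A := `|a| + `|u 1|; have A0 : 0 <= A by rewrite addr_ge0.
have A1 : 0 < A + 1 by rewrite ltr_wpDl.
(* With displacements of norm at most [2 * t * A], this accuracy bounds each remainder strictly
   below the drop [c * t / 2]. *)
have e40 : 0 < c / (4 * (A + 1)) by rewrite divr_gt0// mulr_gt0.
have [d d0 Hd] := sg _ e40.
pose t := Num.min 2^-1 (d / (2 * (A + 1))).
have t0 : 0 < t by rewrite lt_min invr_gt0 ltr0n divr_gt0// mulr_gt0.
have t2 : t <= 2^-1 by rewrite ge_min lexx.
have t1 : t <= 1 by rewrite (le_trans t2)// invf_le1// ler1n.
have td : t * (2 * (A + 1)) <= d by rewrite -ler_pdivlMr ?mulr_gt0// ge_min lexx orbT.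
pose x e := great_circle a (u e) t.
have dist e : `|e| = 1 -> `|u e| = `|u 1| -> `|x e - a| <= 2 * t * A.
  move=> e1 une; have t01 : 0 <= t <= 1 by rewrite ltW.
  rewrite (le_trans (great_circle_dist a (u e) t01))// uu// mulr1 mul1r une.
  by rewrite ler_piMl ?invf_le1 ?mulr_ge0 ?(ltW t0)// ?lerDl ?sqr_ge0// ltr_wpDr// sqr_ge0.
have bound e : `|e| = 1 -> `|u e| = `|u 1| ->
    central_section_volume (x e) - c - dotp g (x e - a) >= - (c / (4 * (A + 1)) * (2 * t * A)).
  move=> e1 une; have xd := dist _ e1 une.
  have := Hd (x e) (usphere_great_circle t a1 (ua e)).
  have near_a : `|x e - a| < d.
    by rewrite (le_lt_trans xd)// (lt_le_trans _ td)//; lra.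
  move=> /(_ near_a); rewrite csv_a ler_norml => /andP[+ _].
  by apply: le_trans; rewrite lerN2 ler_wpM2l// ltW.
have t02 : 0 < t <= 2^-1 by rewrite t0.
have corner e : `|e| = 1 -> central_section_volume (x e) <= c * (1 - t / 2).
  move=> e1; apply: (@section_volume_corner _ _ _ s r e) => //.
  - exact: uu.
  - by rewrite row_of_perm_j.
  - by rewrite row_of_perm_k.
have n1 := normr1 R; have nN1 := normrN1 R.
(* The two displacements add up to a multiple of [a], to which [g] is orthogonal. *)
have dotg : dotp g (x 1 - a) + dotp g (x (-1) - a) = 0.
  rewrite /x !great_circle_sub !dotpZr !dotpDr !dotpZr ga !uu// uN.
  by rewrite -(scaleN1r (u 1)) dotpZr; ring.
have b1 := bound 1 n1 erefl.
have uN1 : `|u (-1)| = `|u 1| by rewrite uN normrN.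
have b2 := bound (-1) nN1 uN1.
have c1 := corner 1 n1; have c2 := corner (-1) nN1.
have : c / (4 * (A + 1)) * (2 * t * A) < c * t / 2.
  have -> : c / (4 * (A + 1)) * (2 * t * A) = c * t / 2 * (A / (A + 1)).
    by field; rewrite gt_eqF.
  have ct0 : 0 < c * t / 2 by rewrite divr_gt0// mulr_gt0.
  by rewrite -[ltRHS]mulr1 (ltr_pM2l ct0) ltr_pdivrMr// mul1r ltrDl.
move: dotg b1 b2 c1 c2; clear.
move: (central_section_volume (x 1)) (central_section_volume (x (-1))) => v1 v2.
move: (dotp g (x 1 - a)) (dotp g (x (-1) - a)) => g1 g2.
move: (c / _ * _) => K; lra.
Qed.

End exceptional_directions.

Theorem theorem1 (R : realType) (n : nat) (n_ge2 : (2 <= n)%N)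
    (a : 'rV[R]_n) (a_unit : usphere a) :
  critical_direction a <->
  (diagonal_2face a \/
   exists2 mu : R, 0 < mu & forall k : 'I_n,
     hvol a (convex_hull ([set 0] `|` (facet k `&` hyperplane a)))
       = (mu * (1 - a 0 k ^+ 2))%:E).
Proof.
case: n n_ge2 a a_unit => [|[|m]]// _ a a1.
(* On a diagonal both sides hold, since a point without a gradient counts as critical. *)
have [da|nda] := pselect (diagonal_2face a).
  split=> _; first by left.
  by split=> //; left; exact: diagonal_no_gradient.
have [g ag] : exists g, cone_gradient a g.
  have [|no] := pselect (exists i j, [/\ i != j, a 0 i != 0 & a 0 j != 0]).
    exact: cone_gradient_exists.
  have [i ai] : exists i, a 0 i != 0.
    apply: contrapT => a0; have aa : dotp a a = 1 := a1.
    have : (1 : R) != 0 by exact: oner_neq0.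
    rewrite -aa /dotp big1 ?eqxx// => i _.
    have [->|ai] := eqVneq (a 0 i) 0; first by rewrite mul0r.
    by case: a0; exists i.
  exists 0; apply: (@cone_gradient_axis _ _ _ (tperm 0 i)) => // l.
  apply/eqP; apply: contra_notT no => al; exists i, (tperm 0 i (lift 0 l)); split=> //.
  by rewrite -{1}(tpermL 0 i) (inj_eq perm_inj).
rewrite (critical_of_cone_gradient a1 ag).
by split=> [|[]//]; right.
Qed.
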